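(* Let $a,b>0$, let $H$ be the gamma subordinator with Laplace exponent $\Phi(\lambda)=a\ln(1+\lambda/b)$ and let $L$ be its inverse. Let $\kappa(x)=\int_0^\infty h(t,x)\,dt$, where $h(t,\cdot)$ is the density of $H_t$, and let $\ell(x)=l(x,0)$, where $l(t,\cdot)$ is the density of $L_t$. Then the associated Sonine kernels $\kappa$ and $\ell$ (that is, $\int_0^x\kappa(z)\,\ell(x-z)\,dz=1$ for all $x>0$) are given by $$\kappa(x)=\frac{b}{a}\,e^{-bx}\,\nu(bx,-1),\qquad \ell(x)=a\,E_1(bx),\qquad x>0 .$$
   Context: Fix $a,b>0$. The gamma subordinator $H=\{H_t\}_{t\ge0}$ is the subordinator started at $H_0=0$ with $\mathbf{E}_0[e^{-\lambda H_t}]=e^{-t\Phi(\lambda)}$, $\lambda\ge0$, where $\Phi(\lambda)=a\ln(1+\lambda/b)=a\int_0^\infty(1-e^{-\lambda y})\frac{e^{-by}}{y}\,dy$. For $t>0$ the law of $H_t$ has density $h(t,x)=\frac{b^{at}}{\Gamma(at)}x^{at-1}e^{-bx}$ for $x>0$ (and $0$ for $x\le 0$). The inverse process is $L_t=\inf\{s>0:H_s\notin(0,t)\}$, $t>0$, and $l(t,x)$ denotes its density: $\mathbf{P}_0(L_t\in dx)=l(t,x)\,dx$. The potential density $\kappa(x)=\int_0^\infty h(t,x)\,dt$ satisfies $\int_0^\infty e^{-\lambda x}\kappa(x)\,dx=\frac{1}{\Phi(\lambda)}$, $\lambda>0$. The function $\ell(t)=l(t,0)$ is understood as the limit of $l(t,x)$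 as $x\downarrow0$; its Laplace transform is $\lim_{x\downarrow 0}\int_0^\infty e^{-\lambda t}l(t,x)\,dt=\frac{\Phi(\lambda)}{\lambda}$, that is, $\ell$ is the tail of the Lévy measure, $\ell(t)=\overline{\Pi}(t)=\int_t^\infty a\frac{e^{-by}}{y}\,dy$. Special functions: $E_1(x)=\int_x^\infty\frac{e^{-z}}{z}\,dz$ for $x>0$, and for $\alpha\in\mathbb{R}$, $x>0$, $\nu(x,\alpha)=\int_0^\infty\frac{x^{\alpha+y}}{\Gamma(\alpha+y+1)}\,dy$ (with $1/\Gamma$ the entire reciprocal gamma function). *)

(* Defs.v *)
From HB Require Import structures.
From mathcomp Require Import all_boot all_order all_algebra.
From mathcomp Require Import all_classical all_reals all_analysis.
From mathcomp Require Import measurable_realfun. (* sigma-algebra on \bar R *)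

Set Implicit Arguments.
Unset Strict Implicit.
Unset Printing Implicit Defensive.

Import Order.TTheory GRing.Theory Num.Theory.
Import numFieldTopology.Exports numFieldNormedType.Exports.

Local Open Scope classical_set_scope.
Local Open Scope ring_scope.

Section special_functions.
Context {R : realType}.
Notation mu := (@lebesgue_measure R).

(* Euler's integral; only meaningful for [0 < x]. *)
Definition Gamma (x : R) : R :=
  \int[mu]_(z in `]0, +oo[) (z `^ (x - 1) * expR (- z)).

(* The entire function 1/Gamma on the real line.  For [x <= 0] it is given by
   1/Gamma(x) = x (x+1) ... (x+n-1) / Gamma(x+n), where [n] is the least natural
   number with [0 < x + n]; it vanishes at 0, -1, -2, ... *)
Definition recip_Gamma (x : R) : R :=
  if 0 < x then (Gamma x)^-1
  else let n := (Num.truncn (- x)).+1 in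
       (\prod_(k < n) (x + k%:R)) / Gamma (x + n%:R).

Definition E1 (x : R) : R :=
  \int[mu]_(z in `]x, +oo[) (expR (- z) / z).

Definition nu (x alpha : R) : R :=
  \int[mu]_(y in `]0, +oo[) (x `^ (alpha + y) * recip_Gamma (alpha + y + 1)).

End special_functions.

Section gamma_subordinator.
Context {R : realType} d {T : measurableType d} (P : probability T R).
Notation mu := (@lebesgue_measure R).

(* The index set is [0, +oo): [H t] is irrelevant for [t < 0].  Left limits
   exist because the paths are nondecreasing. *)
Record is_subordinator (H : R -> {RV P >-> R}) : Prop := IsSubordinator {
  sub_start : {ae P, forall w, H 0 w = 0} ;
  sub_paths : {ae P, forall w,
    (forall s t : R, 0 <= s -> s <= t -> H s w <= H t w) /\
    (forall t : R, 0 <= t -> H s w @[s --> t^'+] --> H t w)} ;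
  sub_stationary : forall (s t : R) (A : set R), 0 <= s -> 0 <= t ->
    measurable A ->
    P ((fun w => H (s + t) w - H s w) @^-1` A) = P (H t @^-1` A) ;
  sub_independent : forall (n : nat) (t : nat -> R) (A : nat -> set R),
    0 <= t 0%N -> (forall i, t i <= t i.+1) -> (forall i, measurable (A i)) ->
    P (\bigcap_(i < n) ((fun w => H (t i.+1) w - H (t i) w)%R @^-1` A i)) =
    (\prod_(i < n) P ((fun w => H (t i.+1) w - H (t i) w)%R @^-1` A i))%E
}.

Definition gamma_exponent (a b lambda : R) : R := a * ln (1 + lambda / b).

Definition is_gamma_subordinator (a b : R) (H : R -> {RV P >-> R}) : Prop :=
  is_subordinator H /\
  forall t lambda, 0 <= t -> 0 <= lambda ->
    ('E_P[fun w => expR (- (lambda * H t w))] =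
     (expR (- (t * gamma_exponent a b lambda)))%:E)%E.

(* Extended-real valued, so that the infimum of the empty set is +oo. *)
Definition first_exit (H : R -> {RV P >-> R}) (t : R) (w : T) : \bar R :=
  ereal_inf [set s%:E | s in [set s : R | 0 < s /\ ~ (0 < H s w < t)]].

(* The paths of [H] are regular only almost surely, so that [first_exit H t] need
   not be measurable when [P] is not complete: [L t] is a measurable version. *)
Definition is_inverse_of (H : R -> {RV P >-> R}) (L : R -> {RV P >-> \bar R}) :
    Prop :=
  forall t, 0 < t -> {ae P, forall w, L t w = first_exit H t w}.

Definition law (X : T -> R) (A : set R) : \bar R := P (X @^-1` A).

(* The law of [X] restricted to the finite reals. *)
Definition elaw (X : T -> \bar R) (A : set R) : \bar R :=
  P (X @^-1` (EFin @` A)).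

(* A density is determined only almost everywhere.  Pointwise values at x > 0 and
   the limit as x decreases to 0 refer to the version that is continuous on
   (0, +oo), whose values there are uniquely determined by [m]. *)
Definition is_density (m : set R -> \bar R) (f : R -> R) : Prop :=
  [/\ measurable_fun setT f,
      forall x, 0 <= f x,
      forall A, measurable A -> m A = (\int[mu]_(x in A) (f x)%:E)%E &
      forall x, 0 < x -> {for x, continuous f}].

(* Extended-real valued: an equality with a real number asserts finiteness. *)
Definition potential_density (h : R -> R -> R) (x : R) : \bar R :=
  (\int[mu]_(t in `]0%R, +oo[) (h t x)%:E)%E.

Definition density_at0 (l : R -> R -> R) (t : R) : R :=
  lim (l t x @[x --> 0^'+]).

Definition sonine_pair (k : R -> \bar R) (l : R -> R) : Prop :=
  forall x, 0 < x -> (\int[mu]_(z in `]0%R, x[) (k z * (l (x - z))%:E) = 1)%E.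

End gamma_subordinator.

(* Main.v *)
(* The law of H_t is identified from its Laplace transform: the moments of exp(-H_t) determine the
   expectations of the Bernstein polynomials of a step function, hence the tail P(H_t > u), and
   continuity then gives the density h(t,x) = b^(at) x^(at-1) e^(-bx) / Gamma(at) for x > 0.

   Put Q_s(u) = Gamma(s,u) / Gamma(s), so that P(H_t >= u) = Q_(at)(bu), and
   Q_s(u) = s phi_u(s) with phi_u(s) = Gamma(s,u) / Gamma(s+1).  Almost surely L_t > x iff
   H_x < t, so the integral of l(t,.) over ]x,y] is Q_(ay)(bt) - Q_(ax)(bt).  As phi_(bt) is
   Lipschitz near 0, l(t,x) tends to a phi_(bt)(0) = a E_1(bt) as x decreases to 0.

   For the Sonine identity, independence of the increments of H gives
     P(H_t < x) - P(H_(t+e) < x) = int_0^x h(t,z) P(H_e > x-z) dz;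
   integrating over t > 0 telescopes the left-hand side:
     int_0^x kappa(z) P(H_e > x-z) dz = int_0^e P(H_t < x) dt.
   Divide by e and let e tend to 0: the right-hand side tends to 1, and P(H_e > u) / e tends to
   a E_1(bu).  Fatou's lemma bounds the limit integral by 1 and the inequality
   Gamma(s,u) <= E_1(u) + s gives the converse bound. *)
Require Import Defs.
From HB Require Import structures.
From mathcomp Require Import all_boot all_order all_algebra.
From mathcomp Require Import all_classical all_reals all_analysis.
From mathcomp Require Import measurable_realfun.
From mathcomp Require Import ring lra.

Import Order.TTheory GRing.Theory Num.Theory.
Import numFieldTopology.Exports numFieldNormedType.Exports.

Local Open Scope classical_set_scope.
Local Open Scope ring_scope.

Set Implicit Arguments.
Unset Strict Implicit.
Unset Printing Implicit Defensive.

(** * Lebesgue integrals and the Gamma function *)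

(** Inverting the product of the Laplace transforms of kappa and ell would by itself give the Sonine
    identity only for almost every x; the argument through increments works at a fixed x. Its price
    is a limit at shape parameter 0, where 1/Gamma(s) vanishes. Hence the quotient
    Gamma(s,u)/Gamma(s+1), which is regular at s = 0, and Lipschitz bounds in s in place of
    derivatives. The Lipschitz constant obtained for Gamma(s,u) blows up as u tends to 0, and u =
    b(x-z) does so inside the convolution. This is why the two halves of the limit differ in kind:
    pointwise convergence suffices for Fatou, while the other half rests on Gamma(s,u) <= E1(u) + s,
    whose error does not depend on u. Densities are known through integrals over intervals only, so
    values at a point come from averages over ]x,y] and continuity at x. Since [nu] is real-valued,
    the formula for kappa contains its finiteness at every x > 0. Finite mass on ]0,x[ would give
    this almost everywhere; a Harnack-type inequality for the gamma densities, uniform in the shape,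
    gives it everywhere. *)

Section affine.
Context {R : realType}.
Notation mu := (@lebesgue_measure R).

(** Lebesgue measure is [c] times its image under the affine map, since both agree on half-open
    intervals. This way the substitution holds for integrands that are merely measurable. *)
Lemma ge0_integral_affine (c d : R) (D : set R) (f : R -> \bar R) :
  0 < c -> measurable D -> measurable_fun D f ->
  (forall x, D x -> (0 <= f x)%E) ->
  (\int[mu]_(x in D) f x =
   c%:E * \int[mu]_(x in (fun x => c * x + d)%R @^-1` D) f (c * x + d)%R)%E.
Proof.
move=> c0 mD mf f0.
pose phi : measurableTypeR R -> measurableTypeR R := fun x => c * x + d.
have mphi : measurable_fun [set: measurableTypeR R] phi.
  by apply: measurable_funD => //; exact: measurable_funM.
pose nu : {measure set (measurableTypeR R) -> \bar R} := mscale (NngNum (ltW c0))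
  (measure_function_pushforward__canonical__measure_function_Measure mu mphi).
have nuE A : measurable A -> mu A = nu A.
  apply: lebesgue_measure_unique => _ [[x y]] _ <- /=.
  rewrite /nu /mscale /pushforward /=.
  rewrite [X in (_ * lebesgue_measure X)%E]
    (_ : _ = `](x - d) / c, (y - d) / c]%classic); last first.
    apply/seteqP; split => z /=; rewrite !in_itv /= /phi.
      by rewrite ltr_pdivrMr// ler_pdivlMr// ltrBlDr lerBrDr mulrC.
    by rewrite ltr_pdivrMr// ler_pdivlMr// ltrBlDr lerBrDr mulrC.
  rewrite !lebesgue_measure_itv /= !lte_fin ltr_pM2r ?invr_gt0// ltrD2r.
  case: ifPn => _; last by rewrite mule0.
  by rewrite -!EFinB -EFinM; congr EFin; field; rewrite gt_eqF.
rewrite (eq_measure_integral nu); last by move=> A mA _; exact: nuE.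
rewrite /nu ge0_integral_mscale//=; congr (_ * _)%E.
by rewrite ge0_integral_pushforward// => x; rewrite inE; exact: f0.
Qed.

End affine.

Section gamma.
Context {R : realType}.
Notation mu := (@lebesgue_measure R).

Lemma integral_powR (s w : R) : 0 < s -> 0 < w ->
  (\int[mu]_(z in `]0%R, w[) (z `^ (s - 1))%:E = (w `^ s / s)%:E)%E.
Proof.
move=> s0 w0.
rewrite integral_itv_bndo_bndc; last first.
  apply/measurable_EFinP; apply: measurable_funTS; exact: measurable_powR.
(* The integrand may be singular at 0, so the fundamental theorem is applied on compact intervals
   exhausting []0, w]]; [n.+2] keeps the left end strictly below [w] even for [n = 0]. *)
pose F (n : nat) := `[w / n.+2%:R, w]%classic.
have FE : (\bigcup_n F n) = `]0, w]%classic.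
  apply/seteqP; split => z /=.
    move=> [n _]; rewrite /F /= !in_itv /= => /andP[h ->]; rewrite andbT.
    by apply: lt_le_trans h; rewrite divr_gt0.
  rewrite in_itv /= => /andP[z0 zw].
  have [n hn] := ltr_add_invr (divr_gt0 z0 w0).
  exists n => //; rewrite /F /= in_itv /= zw andbT.
  move: hn; rewrite add0r ltr_pdivlMr// => /ltW; apply: le_trans.
  rewrite mulrC ler_pM2r// lef_pV2 ?posrE// ler_nat//.
rewrite -FE.
have h1 : (\int[mu]_(z in F n) (z `^ (s - 1))%:E)%E @[n --> \oo] -->
    (\int[mu]_(z in \bigcup_n F n) (z `^ (s - 1))%:E)%E.
  apply: ge0_nondecreasing_set_cvg_integral => //.
  - move=> n m nm; apply/subsetPset => z; rewrite /F /= !in_itv /= => /andP[h ->].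
    rewrite andbT; apply: le_trans h.
    by rewrite ler_pM2l// lef_pV2 ?posrE// ler_nat.
  - move=> i; exact: measurable_itv.
  - move=> i; apply/measurable_EFinP; apply: measurable_funTS; exact: measurable_powR.
  - by move=> i z _; rewrite lee_fin powR_ge0.
have h2 n : (\int[mu]_(z in F n) (z `^ (s - 1))%:E)%E = ((w `^ s - (w / n.+2%:R) `^ s) / s)%:E.
  have w20 : 0 < w / n.+2%:R by rewrite divr_gt0.
  have w2w : w / n.+2%:R < w by rewrite ltr_pdivrMr// ltr_pMr// ltr1n.
  have der (x : R) : 0 < x -> is_derive x (1 : R) (fun z : R => z `^ s / s) (x `^ (s - 1)).
    move=> x0.
    have h : is_derive x (1 : R) (s^-1 \*: (fun z : R => z `^ s))
        (s^-1 *: ((s * x `^ (s - 1)) : R^o)).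
      by apply: is_deriveZ; exact: is_derive1_powR.
    rewrite [X in is_derive _ _ X _](_ : _ = s^-1 \*: (fun z : R => z `^ s)); last first.
      by apply/funext => z /=; rewrite mulrC.
    by apply: is_derive_eq h _; rewrite /GRing.scale /= mulrA mulVf ?mul1r// gt_eqF.
  have cont p (x : R) : 0 < x -> {for x, continuous (fun z : R => z `^ p)}.
    move=> x0; apply: differentiable_continuous; apply/derivable1_diffP.
    by have [] := is_derive1_powR p x0.
  rewrite (@continuous_FTC2 _ _ (fun z => z `^ s / s))//.
  - by rewrite -EFinB -mulrBl.
  - apply: continuous_in_subspaceT => x; rewrite inE /= in_itv /= => /andP[h _].
    by apply: cont; exact: lt_le_trans h.
  - split.
    + move=> x; rewrite in_itv /= => /andP[h _].
      by have [] := der x (lt_trans w20 h).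
    + apply: cvg_at_right_filter; apply: cvgMl; exact: cont.
    + apply: cvg_at_left_filter; apply: cvgMl; exact: cont.
  - move=> x; rewrite in_itv /= => /andP[h _]; rewrite derive1E.
    by have [_ ->] := der x (lt_trans w20 h).
have h3 : (\int[mu]_(z in F n) (z `^ (s - 1))%:E)%E @[n --> \oo] --> (w `^ s / s)%:E.
  under eq_cvg do rewrite h2.
  apply: cvg_EFin; first exact: nearW.
  rewrite [X in _ --> X](_ : _ = (w `^ s - 0) / s); last by rewrite subr0.
  apply: cvgMl; apply: cvgB; first exact: cvg_cst.
  have := powR_cvg0 s0; move/cvg_at_rightP; apply; split.
    by move=> n; rewrite divr_gt0.
  rewrite -(mulr0 w); apply: cvgMr.
  have := @cvg_harmonic R; rewrite /harmonic.
  by rewrite -cvg_shiftS.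
by rewrite (cvg_unique _ h1 h3).
Qed.

Lemma integral_expRN (w : R) :
  (\int[mu]_(z in `]w, +oo[) (expR (- z))%:E = (expR (- w))%:E)%E.
Proof.
rewrite integral_itv_obnd_cbnd; last first.
  apply/measurable_EFinP; apply: measurable_funTS.
  by apply: measurableT_comp => //; exact: measurable_oppr.
have der (x : R) : is_derive x (1 : R) (fun z : R => - expR (- z)) (expR (- x)).
  have h1 : is_derive (- x) (1 : R) (@expR R) (expR (- x)) by exact: is_derive_expR.
  have h2 : is_derive x (1 : R) (-%R : R -> R) (- 1) by exact: is_deriveN.
  have h3 := is_deriveN (is_derive1_comp h1 h2).
  apply: (is_derive_eq h3); by rewrite mulrN1 opprK.
have cont (x : R) : {for x, continuous (fun z : R => expR (- z))}.
  apply: (@continuous_comp R R R (fun z => - z) (@expR R) x).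
    exact: opp_continuous.
  exact: continuous_expR.
rewrite (@ge0_continuous_FTC2y _ _ (fun z => - expR (- z)) w 0)//.
- by rewrite EFinN oppeK add0e.
- by apply: continuous_subspaceT; exact: cont.
- by rewrite -oppr0; apply: cvgN; exact: cvgr_expR.
- by apply: cvg_at_right_filter; apply: cvgN; exact: cont.
- by move=> x _; rewrite derive1E; have [_ ->] := der x.
Qed.

End gamma.

(** Tonelli is applied below to functions on the whole plane that are cut off by a boolean test;
    this turns an inner integral back into one over a section. *)
Lemma integral_if {d} {T : measurableType d} {R : realType}
    (m : {measure set T -> \bar R}) (c : T -> bool) (f : T -> \bar R) (D : set T) :
  (forall x, c x <-> D x) ->
  (\int[m]_x (if c x then f x else 0) = \int[m]_(x in D) f x)%E.
Proof.
move=> cD; rewrite [RHS]integral_mkcond; apply: eq_integral => x _.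
by rewrite patchE; case: ifPn => [/cD/mem_set ->//|cx]; rewrite memNset// => /cD; exact/negP.
Qed.

Arguments integral_if {d T R} m {c f} D.

Section gamma.
Context {R : realType}.
Notation mu := (@lebesgue_measure R).

Definition gker (s z : R) : R := z `^ (s - 1) * expR (- z).

Lemma gker_ge0 s z : 0 <= gker s z.
Proof. by rewrite mulr_ge0 ?powR_ge0 ?expR_ge0. Qed.

Lemma measurable_expRN : measurable_fun [set: R] (fun z : R => expR (- z)).
Proof. by apply: measurableT_comp => //; exact: measurable_oppr. Qed.

Lemma measurable_gker s : measurable_fun [set: R] (gker s).
Proof.
by apply: measurable_funM; [exact: measurable_powR|exact: measurable_expRN].
Qed.

Lemma measurable_gkerE s (D : set R) : measurable_fun D (fun z => (gker s z)%:E).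
Proof. by apply/measurable_EFinP; apply: measurable_funTS; exact: measurable_gker. Qed.

(** Tonelli for x^(s-1) e^(-y) on the region 0 < x < y, in place of integration by parts. The
    identity is between extended reals, so it holds before finiteness is known and serves to prove
    it. *)
Lemma integral_gkerS (s : R) : 0 < s ->
  (\int[mu]_(z in `]0%R, +oo[) (gker (s + 1) z)%:E =
   s%:E * \int[mu]_(z in `]0%R, +oo[) (gker s z)%:E)%E.
Proof.
move=> s0.
pose f (p : R * R) := if (0 < p.1) && (p.1 < p.2) then (p.1 `^ (s - 1) * expR (- p.2))%:E else 0%E.
have mf : measurable_fun [set: R * R] f.
  apply: measurable_fun_ifT => //.
    by apply: measurable_and; apply: measurable_fun_ltr.
  apply/measurable_EFinP; apply: measurable_funM.
    by apply: (measurableT_comp (measurable_powR _)).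
  by apply: (measurableT_comp measurable_expRN).
have f0 p : (0 <= f p)%E.
  by rewrite /f; case: ifP => // _; rewrite lee_fin mulr_ge0 ?powR_ge0 ?expR_ge0.
have := fubini_tonelli (m1 := mu) (m2 := mu) f mf f0.
have -> : (\int[mu]_x \int[mu]_y f (x, y) = \int[mu]_(z in `]0%R, +oo[) (gker s z)%:E)%E.
  rewrite [RHS]integral_mkcond; apply: eq_integral => x _; rewrite patchE.
  case: ifPn => [|xn].
    rewrite inE /= in_itv /= andbT => x0.
    rewrite /f /= x0 /= (integral_if mu `]x, +oo[); last first.
      by move=> y; rewrite /= in_itv /= andbT.
    under eq_integral do rewrite EFinM.
    rewrite ge0_integralZl_EFin ?powR_ge0//=.
    + by rewrite integral_expRN.
    + by apply/measurable_EFinP; apply: measurable_funTS; exact: measurable_expRN.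
  apply: integral0_eq => y _; rewrite /f /=; case: ifPn => // /andP[x0 _].
  by move: xn; rewrite notin_setE /= in_itv /= x0.
have -> : (\int[mu]_y \int[mu]_x f (x, y) =
    s^-1%:E * \int[mu]_(z in `]0%R, +oo[) (gker (s + 1) z)%:E)%E.
  rewrite -ge0_integralZl_EFin ?invr_ge0 ?(ltW s0)//; last 2 first.
    by move=> z _; rewrite lee_fin gker_ge0.
    exact: measurable_gkerE.
  rewrite [RHS]integral_mkcond; apply: eq_integral => y _; rewrite patchE.
  case: ifPn => [|yn].
    rewrite inE /= in_itv /= andbT => y0.
    rewrite /f /= (integral_if mu `]0, y[); last first.
      by move=> x; rewrite /= in_itv.
    under eq_integral do rewrite mulrC EFinM.
    rewrite ge0_integralZl_EFin ?expR_ge0//=.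
    + rewrite integral_powR// -!EFinM /gker addrK; congr EFin; ring.
    + by move=> x _; rewrite lee_fin powR_ge0.
    + by apply/measurable_EFinP; apply: measurable_funTS; exact: measurable_powR.
  apply: integral0_eq => x _; rewrite /f /=; case: ifPn => // /andP[x0 xy].
  by move: yn; rewrite notin_setE /= in_itv /= (lt_trans x0 xy).
by move=> ->; rewrite muleA -EFinM mulfV ?mul1e// gt_eqF.
Qed.

Lemma integral_gker1 : (\int[mu]_(z in `]0%R, +oo[) (gker 1 z)%:E = 1)%E.
Proof.
under eq_integral do rewrite /gker subrr powRr0 mul1r.
by rewrite integral_expRN oppr0 expR0.
Qed.

Lemma integral_gker_nat n : (\int[mu]_(z in `]0%R, +oo[) (gker n.+1%:R z)%:E = n`!%:R%:E)%E.
Proof.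
elim: n => [|n ih]; first by rewrite integral_gker1.
by rewrite -natr1 integral_gkerS// ih -EFinM -natrM factS.
Qed.

(** The recursion raises the exponent from s-1 to s and so removes the singularity at 0; then z^s <=
    1 + z^n for a natural number n >= s, and both terms have known integrals. *)
Lemma integral_gker_fin (s : R) : 0 < s ->
  (\int[mu]_(z in `]0%R, +oo[) (gker s z)%:E \is a fin_num)%E.
Proof.
move=> s0; have -> : (\int[mu]_(z in `]0%R, +oo[) (gker s z)%:E =
    s^-1%:E * \int[mu]_(z in `]0%R, +oo[) (gker (s + 1) z)%:E)%E.
  move: (integral_gkerS s0); set I := integral _ _ _; set J := integral _ _ _ => ->.
  by rewrite muleA -EFinM mulVf ?mul1e// gt_eqF.
rewrite fin_numM// ge0_fin_numE; last first.
  by apply: integral_ge0 => z _; rewrite lee_fin gker_ge0.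
pose n := (Num.truncn s).+1.
have sn : s <= n%:R by rewrite ltW// truncnS_gt.
apply: (@le_lt_trans _ _ (\int[mu]_(z in `]0%R, +oo[) ((gker 1 z)%:E + (gker n.+1%:R z)%:E))%E).
  apply: ge0_le_integral => //.
  - by move=> z _; rewrite lee_fin gker_ge0.
  - exact: measurable_gkerE.
  - by apply: emeasurable_funD; exact: measurable_gkerE.
  - move=> z; rewrite /= in_itv /= andbT => z0.
    rewrite -EFinD lee_fin /gker -mulrDl ler_wpM2r ?expR_ge0//.
    rewrite addrK subrr powRr0 -natr1 addrK.
    have [z1|z1] := leP z 1.
      apply: (@le_trans _ _ 1); last by rewrite lerDl powR_ge0.
      by rewrite -[leRHS](powRr0 z); apply: ger_powR; rewrite ?z0 ?z1// ltW.
    apply: (@le_trans _ _ (z `^ n%:R)); last by rewrite lerDr.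
    by apply: ler_powR => //; exact: ltW.
rewrite ge0_integralD//.
- by rewrite integral_gker1 integral_gker_nat -EFinD ltry.
- by move=> z _; rewrite lee_fin gker_ge0.
- exact: measurable_gkerE.
- by move=> z _; rewrite lee_fin gker_ge0.
- exact: measurable_gkerE.
Qed.

Lemma EFin_Gamma (s : R) : 0 < s ->
  ((Gamma s)%:E = \int[mu]_(z in `]0%R, +oo[) (gker s z)%:E)%E.
Proof. by move=> s0; rewrite /Gamma /Rintegral fineK// integral_gker_fin. Qed.

Lemma GammaS (s : R) : 0 < s -> Gamma (s + 1) = s * Gamma s.
Proof.
move=> s0; apply: EFin_inj.
by rewrite EFinM !EFin_Gamma ?addr_gt0// integral_gkerS.
Qed.

Lemma Gamma1 : Gamma 1 = 1 :> R.
Proof. by apply: EFin_inj; rewrite EFin_Gamma// integral_gker1. Qed.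

(** Beyond 1 the factor z^s is at least 1. This uniform lower bound keeps the denominators of all
    later quotients away from 0. *)
Lemma Gamma_ge_expRN1 (s : R) : 0 <= s -> expR (- 1) <= Gamma (s + 1).
Proof.
move=> s0; rewrite -lee_fin EFin_Gamma ?ltr_wpDl//.
rewrite -integral_expRN.
apply: (@le_trans _ _ (\int[mu]_(z in `]1%R, +oo[) (gker (s + 1) z)%:E)%E).
  apply: ge0_le_integral => //.
  - by apply/measurable_EFinP; apply: measurable_funTS; exact: measurable_expRN.
  - exact: measurable_gkerE.
  - move=> z; rewrite /= in_itv /= andbT => z1.
    rewrite lee_fin /gker addrK ler_peMl ?expR_ge0//.
    by rewrite -(powRr0 z); apply: ler_powR => //; exact: ltW.
apply: ge0_subset_integral => //.
- exact: measurable_gkerE.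
- by move=> z _; rewrite lee_fin gker_ge0.
- by apply: subset_itvr; rewrite bnd_simp.
Qed.

Lemma Gamma_gt0 (s : R) : 0 < s -> 0 < Gamma s.
Proof.
move=> s0; suff : 0 < s * Gamma s by rewrite pmulr_rgt0.
by rewrite -GammaS// (lt_le_trans (expR_gt0 (- 1)))// Gamma_ge_expRN1// ltW.
Qed.

(* [z `^ (s - 1)] in a form that is visibly measurable in [(s, z)] *)
Lemma gkerE (s z : R) : 0 < z -> gker s z = expR ((s - 1) * ln z - z).
Proof. by move=> z0; rewrite expRD /gker /powR gt_eqF. Qed.

Lemma measurable_Gamma : measurable_fun [set: R] (@Gamma R).
Proof.
pose f (p : R * R) := if 0 < p.2 then (expR ((p.1 - 1) * ln p.2 - p.2))%:E else 0%E.
have mf : measurable_fun [set: R * R] f.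
  apply: measurable_fun_ifT => //; first exact: measurable_fun_ltr.
  apply/measurable_EFinP; apply: measurableT_comp => //.
  apply: measurable_funB => //; apply: measurable_funM.
    by apply: measurable_funB.
  by apply: (measurableT_comp (@measurable_ln R)).
have f0 p : (0 <= f p)%E by rewrite /f; case: ifP => // _; rewrite lee_fin expR_ge0.
have := measurable_fun_fubini_tonelli_F (m2 := mu) _ mf f0.
move=> /(measurableT_comp (@fine_measurable R _ measurableT)).
apply: eq_measurable_fun => s _ /=; rewrite /fubini_F /Gamma /Rintegral; congr fine.
rewrite (integral_if mu `]0, +oo[); last first.
  by move=> y; rewrite /= in_itv /= andbT.
by apply: eq_integral => z; rewrite inE /= in_itv /= andbT => z0; rewrite -gkerE.
Qed.

Lemma measurable_Gamma_inv : measurable_fun [set: R] (fun s : R => (Gamma s)^-1).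
Proof.
have G0 (s : R) : 0 <= Gamma s by apply: Rintegral_ge0 => z _; exact: gker_ge0.
rewrite (_ : (fun s : R => _) = (fun s : R => Gamma s `^ (-1))); last first.
  by apply/funext => s; rewrite powR_inv1.
exact: (measurableT_comp (@measurable_powR R (-1)) measurable_Gamma).
Qed.

End gamma.

(** * Elementary bounds for z^s as a function of the exponent *)

Section powR_bounds.
Context {R : realType}.

(** Young's inequality for the product of z^s and 1 with the conjugate exponents 1/s and 1/(1-s),
    which degenerate at the two endpoints. *)
Lemma powR_le_lin (z s : R) : 0 < z -> 0 <= s <= 1 -> z `^ s <= 1 + s * (z - 1).
Proof.
move=> z0 /andP[]; rewrite le_eqVlt => /predU1P[<- _|s0].
  by rewrite powRr0 mul0r addr0.
rewrite le_eqVlt => /predU1P[->|s1]; first by rewrite powRr1 ?(ltW z0)//; lra.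
have := @conjugate_powR R (z `^ s) 1 s^-1 (1 - s)^-1 (powR_ge0 _ _) ler01.
rewrite !invr_gt0 s0 subr_gt0 s1 !invrK subrKC => /(_ isT isT erefl).
by rewrite -powRrM divff ?gt_eqF// powRr1 ?(ltW z0)// powR1 mulr1 => /le_trans; apply; lra.
Qed.

(** From exp u >= 1 + u with u = s ln z, and ln z >= 1 - 1/z. *)
Lemma powR_ge_inv (z s : R) : 0 < z -> 0 <= s -> 1 + s * (1 - z^-1) <= z `^ s.
Proof.
move=> z0 s0; have := expR_ge1Dx (ln z * s); rewrite expRM lnK//.
apply: le_trans; rewrite lerD2l mulrC ler_wpM2r// -[ln z]opprK -lnV// lerNr opprB.
by have := @le_ln1Dx R (z^-1 - 1); rewrite subrKC; apply; rewrite ltrBrDr addNr invr_gt0.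
Qed.

(** Factor out z^s, which is at most 1 + z, and bound z^(s'-s) - 1 from both sides by the two
    preceding lemmas. The constant is a Laurent polynomial in z, without logarithms, so that it can
    be integrated against gamma kernels. *)
Lemma powR_lip (z s s' : R) : 0 < z -> 0 <= s -> s <= s' -> s' <= 1 ->
  `|z `^ s' - z `^ s| <= (s' - s) * ((1 + z) * (z + z^-1)).
Proof.
move=> z0 s0 ss' s'1.
have d01 : 0 <= s' - s <= 1 by apply/andP; split; lra.
have d0 : 0 <= s' - s by lra.
have zi0 : 0 < z^-1 by rewrite invr_gt0.
have -> : z `^ s' - z `^ s = z `^ s * (z `^ (s' - s) - 1).
  rewrite mulrBr mulr1 -powRD ?subrKC//; apply/implyP => _; exact: lt0r_neq0.
rewrite normrM (ger0_norm (powR_ge0 _ _)) mulrCA; apply: ler_pM => //.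
- exact: powR_ge0.
- apply: le_trans (powR_le_lin z0 _) _; first by rewrite s0 (le_trans ss').
  have : s * (z - 1) <= 1 * z by nra.
  lra.
- have h1 := powR_le_lin z0 d01.
  have h2 := powR_ge_inv z0 d0.
  rewrite ler_norml; apply/andP; split; nra.
Qed.

End powR_bounds.

Lemma Rintegral_lip {d} {T : measurableType d} {R : realType}
    (m : {measure set T -> \bar R}) (D : set T) (f g M : T -> R) (C : R) :
  measurable D -> m.-integrable D (EFin \o f) -> m.-integrable D (EFin \o g) ->
  m.-integrable D (EFin \o M) ->
  (forall z, D z -> `|f z - g z| <= C * M z) ->
  `|\int[m]_(z in D) f z - \int[m]_(z in D) g z| <= C * \int[m]_(z in D) M z.
Proof.
move=> mD fi gi Mi fgM.
have fgi : m.-integrable D (EFin \o (f \- g)) by exact: (integrableB mD fi gi).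
rewrite -RintegralB//; apply: le_trans (le_normr_Rintegral mD fgi) _.
rewrite -RintegralZl//; apply: le_Rintegral => //.
  exact: integrable_norm.
exact: (integrableZl mD C Mi).
Qed.

(** * The upper incomplete gamma function and its regularity in the exponent *)

Section incomplete_gamma.
Context {R : realType}.
Notation mu := (@lebesgue_measure R).

Lemma integrable_gker s : 0 < s -> mu.-integrable `]0, +oo[ (fun z : R => (gker s z)%:E).
Proof.
move=> s0; apply/integrableP; split; first exact: measurable_gkerE.
under eq_integral do rewrite /= ger0_norm ?gker_ge0//.
by rewrite -EFin_Gamma// ltry.
Qed.

(** Beyond [c] one has z^(s-1) <= z^s / c, which also covers s = 0, the case of E1. *)
Lemma integrable_gker_tail s c : 0 <= s -> 0 < c ->
  mu.-integrable `]c, +oo[ (fun z : R => (gker s z)%:E).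
Proof.
move=> s0 c0.
have : mu.-integrable `]c, +oo[ (fun z : R => (c^-1%:E * (gker (s + 1) z)%:E)%E).
  apply: integrableZl => //; apply: integrableS (integrable_gker _) => //.
    by apply: subset_itvr; rewrite bnd_simp ltW.
  by rewrite ltr_wpDl.
apply: le_integrable => //; first exact: measurable_gkerE.
move=> z; rewrite /= in_itv /= andbT => cz.
have z0 : 0 < z by exact: lt_trans cz.
rewrite lee_fin !ger0_norm ?gker_ge0 ?mulr_ge0 ?gker_ge0 ?invr_ge0 ?(ltW c0) ?powR_ge0//.
rewrite /gker addrK mulrA ler_wpM2r ?expR_ge0//.
have -> : z `^ s = z `^ (s - 1) * z.
  by rewrite -[in LHS](subrK 1 s) powRD ?powRr1 ?(ltW z0)//; apply/implyP => _; exact: lt0r_neq0.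
by rewrite mulrCA ler_peMr ?powR_ge0// mulrC ler_pdivlMr// mul1r ltW.
Qed.

(** The upper incomplete gamma function Gamma(s, c). *)
Definition igamma (s c : R) : R := \int[mu]_(z in `]c, +oo[) gker s z.

Lemma igamma_ge0 s c : 0 <= igamma s c.
Proof. by apply: Rintegral_ge0 => z _; exact: gker_ge0. Qed.

Lemma EFin_igamma s c : 0 <= s -> 0 < c ->
  ((igamma s c)%:E = \int[mu]_(z in `]c, +oo[) (gker s z)%:E)%E.
Proof.
by move=> s0 c0; rewrite fineK//; apply: integrable_fin_num => //; exact: integrable_gker_tail.
Qed.

Lemma igamma0 c : 0 < c -> igamma 0 c = E1 c.
Proof.
move=> c0; apply: eq_Rintegral => z; rewrite inE /= in_itv /= andbT => cz.
have z0 : 0 < z := lt_trans c0 cz.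
by rewrite /gker sub0r powR_inv1 ?(ltW z0)// mulrC.
Qed.

(** By [powR_le_lin], z^(s-1) <= z^-1 + s, and exp(-z) has mass at most 1 beyond [c]. The error [s]
    is uniform in [c], so it survives integration over levels [c] that approach 0. *)
Lemma igamma_le s c : 0 <= s <= 1 -> 0 < c -> igamma s c <= E1 c + s.
Proof.
move=> s01 c0; have /andP[s0 s1] := s01.
rewrite -lee_fin EFin_igamma// -igamma0// EFinD EFin_igamma//.
have m1 : measurable_fun `]c, +oo[ (fun z : R => (expR (- z))%:E).
  by apply/measurable_EFinP; apply: measurable_funTS; exact: measurable_expRN.
have se : (s%:E * \int[mu]_(z in `]c, +oo[) (expR (- z))%:E <= s%:E)%E.
  rewrite integral_expRN -EFinM lee_fin ler_piMr// -expR0 ler_expR.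
  by rewrite oppr_le0 ltW.
apply: le_trans (leeD2l _ se).
rewrite -ge0_integralZl_EFin//.
rewrite -ge0_integralD//.
- apply: ge0_le_integral => //.
  + by move=> z _; rewrite lee_fin gker_ge0.
  + exact: measurable_gkerE.
  + apply: emeasurable_funD; first exact: measurable_gkerE.
    exact: measurable_funeM.
  + move=> z; rewrite /= in_itv /= andbT => cz.
    have z0 : 0 < z by exact: lt_trans cz.
    rewrite -EFinM -EFinD lee_fin /gker -mulrDl ler_wpM2r ?expR_ge0//.
    have zs : z `^ (s - 1) = z^-1 * z `^ s.
      rewrite addrC powRD; last by apply/implyP => _; exact: lt0r_neq0.
      by rewrite powR_inv1 ?(ltW z0).
    rewrite zs sub0r powR_inv1 ?(ltW z0)//.
    have zi0 : 0 < z^-1 by rewrite invr_gt0.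
    have h : z^-1 * z `^ s <= z^-1 * (1 + s * (z - 1)).
      by apply: (ler_wpM2l (ltW zi0)); exact: powR_le_lin.
    apply: le_trans h _; rewrite mulrDr mulr1 mulrCA mulrBr mulVf ?gt_eqF// mulr1; nra.
- by move=> z _; rewrite lee_fin gker_ge0.
- exact: measurable_gkerE.
- by move=> z _; rewrite mule_ge0 ?lee_fin// expR_ge0.
- exact: measurable_funeM.
Qed.

(** Up to a power of z this is the constant of [powR_lip] times exp(-z). Written as a sum of gamma
    kernels it is integrable term by term. *)
Let M (z : R) := gker 1%:R z + gker 2%:R z + gker 3%:R z + gker 4%:R z.

Let ME z : 0 < z -> M z = (1 + z) * (z ^+ 2 + 1) * expR (- z).
Proof.
move=> z0; have e n : gker n.+1%:R z = z ^+ n * expR (- z).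
  by rewrite /gker -natr1 addrK powR_mulrn// ltW.
rewrite /M !e; ring.
Qed.

Let integrable_M c : 0 <= c -> mu.-integrable `]c, +oo[ (EFin \o M).
Proof.
move=> c0; apply: integrableS (_ : mu.-integrable `]0, +oo[ _) => //.
  by apply: subset_itvr; rewrite bnd_simp.
have e (n : nat) : mu.-integrable `]0, +oo[ (fun z : R => (gker n.+1%:R z)%:E).
  by apply: integrable_gker.
have m : measurable (`]0, +oo[ : set R) by [].
have i1 := integrableD (mu := mu) m (e 0%N) (e 1%N).
have i2 := integrableD (mu := mu) m i1 (e 2%N).
exact: (integrableD (mu := mu) m i2 (e 3%N)).
Qed.

(** The argument s + 2 supplies a factor z that cancels the z^-1 in the constant of [powR_lip]; with
    s + 1 the majorant would not be integrable at 0. *)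
Lemma Gamma_lip : exists2 K : R, 0 <= K & forall s s', 0 <= s -> s <= s' -> s' <= 1 ->
  `|Gamma (s' + 2) - Gamma (s + 2)| <= K * (s' - s).
Proof.
exists (\int[mu]_(z in `]0, +oo[) M z).
  by apply: Rintegral_ge0 => z _; rewrite !addr_ge0 ?gker_ge0.
move=> s s' s0 ss' s'1; rewrite mulrC; apply: Rintegral_lip => //.
- by apply: integrable_gker; lra.
- by apply: integrable_gker; lra.
- exact: integrable_M.
move=> z; rewrite /= in_itv /= andbT => z0.
have e t : z `^ (t + 2 - 1) = z * z `^ t.
  rewrite (_ : t + 2 - 1 = 1 + t); last by lra.
  rewrite powRD ?powRr1 ?ltW//; apply/implyP => _; exact: lt0r_neq0.
rewrite !e -!mulrBl -mulrBr normrM (ger0_norm (expR_ge0 _)) ME// mulrA.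
rewrite ler_wpM2r ?expR_ge0// normrM gtr0_norm//.
apply: le_trans (ler_wpM2l (ltW z0) (powR_lip z0 s0 ss' s'1)) _.
by rewrite le_eqVlt; apply/orP; left; apply/eqP; field; rewrite gt_eqF.
Qed.

Lemma igamma_lip c : 0 < c -> exists2 K : R, 0 <= K &
  forall s s', 0 <= s -> s <= s' -> s' <= 1 ->
  `|igamma s' c - igamma s c| <= K * (s' - s).
Proof.
(* Here z^(s-1) = z^-1 z^s, so together with the z^-1 in [powR_lip] a factor z^-2 appears, at most
   c^-2 on the tail. *)
move=> c0; exists (c ^- 2 * \int[mu]_(z in `]c, +oo[) M z).
  rewrite mulr_ge0 ?invr_ge0 ?exprn_ge0 ?(ltW c0)//.
  by apply: Rintegral_ge0 => z _; rewrite !addr_ge0 ?gker_ge0.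
move=> s s' s0 ss' s'1; rewrite mulrC mulrA; apply: Rintegral_lip => //.
- by apply: integrable_gker_tail; lra.
- by apply: integrable_gker_tail; lra.
- by apply: integrable_M; exact: ltW.
move=> z; rewrite /= in_itv /= andbT => cz.
have z0 : 0 < z by exact: lt_trans cz.
have e t : z `^ (t - 1) = z^-1 * z `^ t.
  rewrite addrC powRD; last by apply/implyP => _; exact: lt0r_neq0.
  by rewrite powR_inv1 ?(ltW z0).
rewrite /gker !e -!mulrBl -mulrBr normrM (ger0_norm (expR_ge0 _)) ME// mulrA.
rewrite ler_wpM2r ?expR_ge0// normrM gtr0_norm ?invr_gt0//.
have zi : 0 < z^-1 by rewrite invr_gt0.
apply: le_trans (ler_wpM2l (ltW zi) (powR_lip z0 s0 ss' s'1)) _.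
rewrite (_ : z^-1 * _ = (s' - s) * z ^- 2 * ((1 + z) * (z ^+ 2 + 1))); last first.
  by field; rewrite gt_eqF.
rewrite ler_wpM2r// ?mulr_ge0 ?addr_ge0 ?sqr_ge0 ?(ltW z0)//.
rewrite ler_wpM2l ?subr_ge0// lef_pV2 ?posrE ?exprn_gt0//.
by rewrite lerXn2r ?nnegrE ?ltW.
Qed.

(** At s = 0 the quotient is E1 c, so this controls every limit below. As [Gamma_lip] concerns the
    argument s + 2, the quotient is rewritten as (s + 1) Gamma(s,c) / Gamma(s+2). *)
Lemma igamma_quot_lip c : 0 < c -> exists2 K : R, 0 <= K &
  forall s s', 0 <= s -> s <= s' -> s' <= 1 ->
  `|igamma s' c / Gamma (s' + 1) - igamma s c / Gamma (s + 1)| <= K * (s' - s).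
Proof.
move=> c0.
have [K1 K10 H1] := Gamma_lip.
have [K2 K20 H2] := igamma_lip c0.
set e := expR (- 1 : R).
have e0 : 0 < e by exact: expR_gt0.
have E0 : 0 <= E1 c by rewrite -igamma0// igamma_ge0.
(* The first term pays for the increment of the factor s + 1. The 2 bounds s' + 1, and the bracket
   is the quotient rule, with numerators at most E1 c + 1 and denominators at least [e], that is
   exp(-1). *)
exists ((E1 c + 1) / e + 2 * (K2 / e + (E1 c + 1) * K1 / e ^+ 2)).
  have p0 : 0 <= e^-1 by rewrite invr_ge0 ltW.
  have q0 : 0 <= e ^- 2 by rewrite invr_ge0 exprn_ge0 ?ltW.
  have r0 : 0 <= E1 c + 1 by rewrite addr_ge0.
  by rewrite addr_ge0 ?(mulr_ge0 r0)// mulr_ge0// addr_ge0 ?mulr_ge0.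
move=> s s' s0 ss' s'1.
have G t : 0 <= t -> igamma t c / Gamma (t + 1) = (t + 1) * (igamma t c / Gamma (t + 2)).
  move=> t0; have t1 : 0 < t + 1 by lra.
  rewrite (_ : t + 2 = t + 1 + 1); last by lra.
  by rewrite [in RHS]GammaS//; field; rewrite !gt_eqF ?Gamma_gt0.
have Ge t : 0 <= t -> e <= Gamma (t + 2).
  move=> t0; rewrite (_ : t + 2 = t + 1 + 1); last by lra.
  by apply: Gamma_ge_expRN1; lra.
have I t : 0 <= t -> t <= 1 -> igamma t c <= E1 c + 1.
  move=> t0 t1; apply: le_trans (igamma_le _ c0) _; first by rewrite t0 t1.
  by rewrite lerD2l.
have s'0 : 0 <= s' by lra.
have s1 : s <= 1 by lra.
rewrite (G _ s'0) (G _ s0).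
have h1 := H1 _ _ s0 ss' s'1; have h2 := H2 _ _ s0 ss' s'1.
move: (Ge _ s0) (Ge _ s'0) (I _ s0 s1) (I _ s'0 s'1) (igamma_ge0 s c) (igamma_ge0 s' c) h1 h2.
move: (Gamma (s + 2)) (Gamma (s' + 2)) (igamma s c) (igamma s' c) (E1 c + 1) => B B' A A' E.
move=> eB eB' AE A'E A0 A'0 BB AA.
have B0 : 0 < B by exact: lt_le_trans eB.
have B'0 : 0 < B' by exact: lt_le_trans eB'.
set d := s' - s in BB AA *.
have d0 : 0 <= d by rewrite subr_ge0.
have -> : (s' + 1) * (A' / B') - (s + 1) * (A / B) =
  d * (A / B) + (s' + 1) * ((A' - A) / B' + A * (B - B') / (B * B')).
  by rewrite /d; field; rewrite !gt_eqF.
have iB : B^-1 <= e^-1 by rewrite lef_pV2.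
have iB' : B'^-1 <= e^-1 by rewrite lef_pV2.
have iB0 : 0 <= B^-1 by rewrite invr_ge0 ltW.
have iB'0 : 0 <= B'^-1 by rewrite invr_ge0 ltW.
rewrite [leRHS]mulrDl; apply: le_trans (ler_normD _ _) _; apply: lerD.
  rewrite normrM (ger0_norm d0) mulrC ler_wpM2r// ger0_norm ?mulr_ge0//.
  exact: ler_pM.
rewrite normrM -[2 * _ * d]mulrA ger0_norm; last by lra.
apply: ler_pM => //; [by lra|by lra|].
rewrite [leRHS]mulrDl; apply: le_trans (ler_normD _ _) _; apply: lerD.
  by rewrite normrM (ger0_norm iB'0) mulrAC; exact: ler_pM.
rewrite invfM !normrM (ger0_norm iB'0) (ger0_norm iB0) (ger0_norm A0).
have h3 : A * `|B - B'| <= E * (K1 * d) by apply: ler_pM => //; rewrite distrC.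
have h4 : B^-1 * B'^-1 <= e^-1 * e^-1 by exact: ler_pM.
rewrite (_ : E * K1 / e ^+ 2 * d = E * (K1 * d) * (e^-1 * e^-1)).
  by apply: ler_pM => //; rewrite mulr_ge0.
by field; rewrite gt_eqF.
Qed.

End incomplete_gamma.

(** * Bernstein polynomials and uniqueness of Laplace transforms *)

Section bernstein.
Context {R : realType}.
Implicit Types (f g : nat -> R) (y : R).

(* the expectation of [f N] for [N] binomial with parameters [n] and [y] *)
Fixpoint bernstein n f y : R :=
  if n is m.+1 then y * bernstein m (fun j => f j.+1) y + (1 - y) * bernstein m f y
  else f 0%N.

Lemma bernstein_cst n k y : bernstein n (fun=> k) y = k.
Proof. by elim: n => //= n ->; ring. Qed.

Lemma bernsteinZ n k f y : bernstein n (fun j => k * f j) y = k * bernstein n f y.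
Proof. by elim: n f => //= n ih f; rewrite !ih; ring. Qed.

Lemma bernsteinB n f g y :
  bernstein n (fun j => f j - g j) y = bernstein n f y - bernstein n g y.
Proof. by elim: n f g => //= n ih f g; rewrite !ih; ring. Qed.

Lemma le_bernstein n f g y : 0 <= y <= 1 -> (forall j, f j <= g j) ->
  bernstein n f y <= bernstein n g y.
Proof.
move=> /andP[y0 y1]; elim: n f g => //= n ih f g fg.
by apply: lerD; apply: ler_wpM2l; rewrite ?subr_ge0 ?ih.
Qed.

(** The second moment is taken about an arbitrary centre because the recursion replaces [a] by
    [a - 1]; the variance is the case a = n y. *)
Lemma bernstein_variance n a y :
  bernstein n (fun j => (j%:R - a) ^+ 2) y = (n%:R * y - a) ^+ 2 + n%:R * (y * (1 - y)).
Proof.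
elim: n a => [|n ih] a /=; first by ring.
rewrite (_ : (fun j => (j.+1%:R - a) ^+ 2) = (fun j => (j%:R - (a - 1)) ^+ 2)); last first.
  by apply/funext => j; congr (_ ^+ 2); rewrite -natr1; ring.
by rewrite !ih -natr1; ring.
Qed.

Lemma bernstein_horner n f : exists p : {poly R}, forall y, bernstein n f y = p.[y].
Proof.
elim: n f => [|n ih] f /=; first by exists (f 0%N)%:P => y; rewrite hornerC.
have [p pE] := ih (fun j => f j.+1); have [q qE] := ih f.
by exists ('X * p + (1 - 'X) * q) => y; rewrite pE qE !hornerE.
Qed.

(** Chebyshev's inequality: when the step at j/n differs from the step at y, these points lie on
    different sides of [c], so |j - n y| >= n |y - c|. The variance n y (1 - y) is then bounded by
    n. *)
Lemma bernstein_step_le n c y : 0 <= y <= 1 -> y != c -> (0 < n)%N ->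
  `|bernstein n (fun j => (j%:R < n%:R * c)%R%:R) y - (y < c)%R%:R|
  <= (n%:R * (y - c) ^+ 2)^-1.
Proof.
move=> y01 yc n0; have /andP[y0 y1] := y01.
have n0' : 0 < n%:R :> R by rewrite ltr0n.
pose K := (n%:R * (y - c)) ^- 2 : R.
have D0 : 0 < (n%:R * (y - c)) ^+ 2.
  by rewrite exprn_even_gt0//= mulf_neq0 ?subr_eq0// gt_eqF.
have K0 : 0 <= K by rewrite invr_ge0 ltW.
rewrite -[X in _ - X](bernstein_cst n _ y) -bernsteinB.
have key j : `|(j%:R < n%:R * c)%R%:R - (y < c)%R%:R| <= K * (j%:R - n%:R * y) ^+ 2 :> R.
  have [h|h] := eqVneq (j%:R < n%:R * c)%R (y < c)%R.
    by rewrite h subrr normr0 mulr_ge0 ?sqr_ge0.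
  have -> : `|(j%:R < n%:R * c)%R%:R - (y < c)%R%:R| = 1 :> R.
    by move: h; case: (_ < n%:R * c); case: (y < c) => //= _; rewrite ?subr0 ?sub0r ?normrN normr1.
  rewrite /K mulrC ler_pdivlMr// mul1r.
  rewrite -[leLHS]real_normK ?num_real// -[leRHS]real_normK ?num_real//.
  rewrite lerXn2r ?nnegrE// mulrBr.
  move: h; have [h1|h1] := ltP (j%:R) (n%:R * c); have [h2|h2] := ltP y c => //= _.
    have h3 : n%:R * c <= n%:R * y by rewrite ler_pM2l.
    rewrite ger0_norm ?subr_ge0// ler0_norm ?subr_le0; lra.
  have h3 : n%:R * y < n%:R * c by rewrite ltr_pM2l.
  rewrite ltr0_norm ?subr_lt0// ger0_norm ?subr_ge0; lra.
have up : bernstein n (fun j => (j%:R < n%:R * c)%R%:R - (y < c)%R%:R) y <=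
    bernstein n (fun j => K * (j%:R - n%:R * y) ^+ 2) y.
  by apply: le_bernstein => // j; exact: le_trans (ler_norm _) (key j).
have lo : bernstein n (fun j => - K * (j%:R - n%:R * y) ^+ 2) y <=
    bernstein n (fun j => (j%:R < n%:R * c)%R%:R - (y < c)%R%:R) y.
  apply: le_bernstein => // j; rewrite mulNr lerNl.
  by apply: le_trans (key j); rewrite -normrN ler_norm.
apply: (@le_trans _ _ (K * (n%:R * (y * (1 - y))))).
  move: up lo; rewrite !bernsteinZ bernstein_variance subrr expr0n /= add0r => up lo.
  by rewrite ler_norml up andbT -mulNr.
have -> : (n%:R * (y - c) ^+ 2)^-1 = K * n%:R.
  by rewrite /K; field; rewrite subr_eq0 yc gt_eqF.
rewrite mulrA ler_piMr ?mulr_ge0 ?(ltW n0')//; nra.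
Qed.

Lemma cvg_bernstein_step c y : 0 <= y <= 1 -> y != c ->
  bernstein n (fun j => (j%:R < n%:R * c)%R%:R) y @[n --> \oo] --> ((y < c)%R%:R : R).
Proof.
move=> y01 yc; apply/cvgrPdist_le => e e0.
have d0 : 0 < e * (y - c) ^+ 2.
  by rewrite mulr_gt0// exprn_even_gt0//= subr_eq0.
near=> n.
have n0 : (0 < n)%N by near: n; exact: nbhs_infty_gt.
rewrite distrC; apply: le_trans (bernstein_step_le y01 yc n0) _.
have n0' : 0 < n%:R :> R by rewrite ltr0n.
rewrite -[e]invrK lef_pV2 ?posrE ?invr_gt0//; last first.
  by rewrite mulr_gt0// exprn_even_gt0//= subr_eq0.
rewrite -ler_pdivrMr; last by rewrite exprn_even_gt0//= subr_eq0.
rewrite -invfM; near: n; exact: nbhs_infty_ger.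
Unshelve. all: by end_near. Qed.

End bernstein.

(** * Measures on [0, 1] and their moments *)

Section moments.
Context {R : realType} {d} {T : measurableType d} {m : {measure set T -> \bar R}}.
Context {Y w : T -> R}.
Hypotheses (mY : measurable_fun [set: T] Y) (Y01 : forall t, 0 <= Y t <= 1).
Hypotheses (w0 : forall t, 0 <= w t) (wi : m.-integrable [set: T] (EFin \o w)).

Let mw : measurable_fun [set: T] w.
Proof. by apply/measurable_EFinP; have /integrableP[] := wi. Qed.

Let integrable_bounded (f : T -> R) : measurable_fun [set: T] f ->
  (forall t, `|f t| <= 1) -> m.-integrable [set: T] (fun t => (f t * w t)%:E).
Proof.
move=> mf f1; apply: (le_integrable _ _ _ wi) => //.
  by apply/measurable_EFinP; exact: measurable_funM.
move=> t _; rewrite /= lee_fin normrM (ger0_norm (w0 t)).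
by rewrite -[leRHS]mul1r ler_wpM2r.
Qed.

Let integrable_moment i : m.-integrable [set: T] (fun t => (Y t ^+ i * w t)%:E).
Proof.
apply: integrable_bounded => [|t]; first exact: measurable_funX.
have /andP[h0 h1] := Y01 t.
by rewrite normrX exprn_ile1// ger0_norm.
Qed.

Lemma integral_horner (p : {poly R}) :
  \int[m]_t (p.[Y t] * w t) = \sum_(i < size p) p`_i * \int[m]_t (Y t ^+ i * w t).
Proof.
rewrite /Rintegral.
under eq_integral.
  move=> t _; rewrite horner_coef mulr_suml -sumEFin.
  under eq_bigr do rewrite -mulrA EFinM.
  over.
rewrite integral_sum//; last first.
  by move=> i; apply: integrableZl.
rewrite -[RHS]/(fine (\sum_(i < size p) p`_i * \int[m]_t (Y t ^+ i * w t))%:E).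
rewrite -sumEFin; congr fine; apply: eq_bigr => i _.
rewrite integralZl// EFinM fineK//; exact: integrable_fin_num.
Qed.

Lemma cvg_integral_bernstein c : m [set t | Y t = c] = 0%E ->
  \int[m]_t (bernstein n (fun j => (j%:R < n%:R * c)%R%:R) (Y t) * w t) @[n --> \oo]
    --> \int[m]_t ((Y t < c)%R%:R * w t).
Proof.
move=> Yc.
have mB n f : measurable_fun [set: T] (fun t => bernstein n f (Y t)).
  have mY' : measurable_fun [set: T] (fun t => 1 - Y t) by exact: measurable_funB.
  elim: n f => [|n ih] f /=; first exact: measurable_cst.
  by apply: measurable_funD; apply: measurable_funM.
have mI : measurable_fun [set: T] (fun t => (Y t < c)%R%:R * w t : R).
  apply: measurable_funM => //.
  rewrite (_ : (fun t => _) = (fun t => if Y t < c then 1 else 0)); last first.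
    by apply/funext => t; case: ifP.
  by apply: measurable_fun_ifT => //; apply: measurable_fun_ltr.
have B1 n t : `|bernstein n (fun j => (j%:R < n%:R * c)%R%:R) (Y t)| <= 1.
  rewrite ger0_norm.
    rewrite -[leRHS](bernstein_cst n 1 (Y t)); apply: le_bernstein => // j.
    by case: (_ < _).
  rewrite -[leLHS](bernstein_cst n 0 (Y t)); apply: le_bernstein => // j.
have [] := @dominated_convergence _ _ _ m setT measurableT
  (fun n t => (bernstein n (fun j => (j%:R < n%:R * c)%R%:R) (Y t) * w t)%:E)
  (fun t => ((Y t < c)%R%:R * w t)%:E) (EFin \o w) _ _ _ wi.
- by move=> n; apply/measurable_EFinP; exact: measurable_funM.
- exact/measurable_EFinP.
- exists [set t | Y t = c]; split => //.
    by rewrite -[X in measurable X]setTI; exact: (mY measurableT (measurable_set1 c)).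
  move=> t /=; apply: contra_notP => /eqP yc _.
  apply: cvg_EFin; first exact: nearW.
  by apply: cvgMl; exact: cvg_bernstein_step.
- apply: aeW => t n _ /=; rewrite /= lee_fin normrM (ger0_norm (w0 t)).
  by rewrite -[leRHS]mul1r ler_wpM2r.
move=> ii _ h; apply: fine_cvg; rewrite fineK//; exact: integrable_fin_num.
Qed.

End moments.

(** Bernstein polynomials are polynomials, so equal moments give equal integrals, and these converge
    to the integrals of the step function because [c] carries no mass. The weights let one side be a
    probability measure with weight 1 and the other Lebesgue measure with a density. *)
Lemma integral_lt_unique {R : realType} {d1 d2} {T1 : measurableType d1} {T2 : measurableType d2}
    {m1 : {measure set T1 -> \bar R}} {m2 : {measure set T2 -> \bar R}}
    {Y1 w1 : T1 -> R} {Y2 w2 : T2 -> R} (c : R) :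
  measurable_fun [set: T1] Y1 -> (forall t, 0 <= Y1 t <= 1) ->
  (forall t, 0 <= w1 t) -> m1.-integrable [set: T1] (EFin \o w1) ->
  m1 [set t | Y1 t = c] = 0%E ->
  measurable_fun [set: T2] Y2 -> (forall t, 0 <= Y2 t <= 1) ->
  (forall t, 0 <= w2 t) -> m2.-integrable [set: T2] (EFin \o w2) ->
  m2 [set t | Y2 t = c] = 0%E ->
  (forall k : nat, \int[m1]_t (Y1 t ^+ k * w1 t) = \int[m2]_t (Y2 t ^+ k * w2 t)) ->
  \int[m1]_t ((Y1 t < c)%R%:R * w1 t) = \int[m2]_t ((Y2 t < c)%R%:R * w2 t).
Proof.
move=> mY1 Y1b w10 wi1 c1 mY2 Y2b w20 wi2 c2 E.
have h1 := cvg_integral_bernstein mY1 Y1b w10 wi1 c1.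
have h2 := cvg_integral_bernstein mY2 Y2b w20 wi2 c2.
have e n : \int[m1]_t (bernstein n (fun j => (j%:R < n%:R * c)%R%:R) (Y1 t) * w1 t) =
    \int[m2]_t (bernstein n (fun j => (j%:R < n%:R * c)%R%:R) (Y2 t) * w2 t).
  have [p pE] := bernstein_horner n (fun j => (j%:R < n%:R * c)%R%:R : R).
  under [LHS]eq_Rintegral do rewrite pE.
  under [RHS]eq_Rintegral do rewrite pE.
  by rewrite !integral_horner//; apply: eq_bigr => i _; rewrite E.
move: h1; under eq_cvg do rewrite e.
by move=> /cvg_unique; apply.
Qed.

(** * The law of the gamma subordinator *)

Section gamma_density.
Context {R : realType}.
Notation mu := (@lebesgue_measure R).
Implicit Types b s z u k : R.

(** For z > 0, the gamma density with shape [s] and rate [b]. As a rescaled kernel it has tails that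
    an affine substitution turns into incomplete gamma functions. *)
Definition gamma_pdf b s z := b / Gamma s * gker s (b * z).

Lemma gamma_pdf_ge0 b s z : 0 <= b -> 0 < s -> 0 <= gamma_pdf b s z.
Proof. by move=> b0 s0; rewrite mulr_ge0 ?gker_ge0 ?divr_ge0 ?(ltW (Gamma_gt0 s0)). Qed.

Lemma measurable_gamma_pdf b s (D : set R) : measurable_fun D (gamma_pdf b s).
Proof.
apply: measurable_funTS; apply: measurable_funM => //.
by apply: (measurableT_comp (measurable_gker s)); exact: measurable_funM.
Qed.

Lemma integral_gamma_pdf b s u : 0 < b -> 0 < s ->
  (\int[mu]_(z in `]u, +oo[) (gamma_pdf b s z)%:E =
   (Gamma s)^-1%:E * \int[mu]_(z in `](b * u)%R, +oo[) (gker s z)%:E)%E.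
Proof.
move=> b0 s0.
rewrite (@ge0_integral_affine R b 0 `](b * u)%R, +oo[)//; last 2 first.
- exact: measurable_gkerE.
- by move=> z _; rewrite lee_fin gker_ge0.
have -> : (fun x => b * x + 0) @^-1` `]b * u, +oo[ = `]u, +oo[%classic.
  by apply/seteqP; split => z; rewrite /= !in_itv /= !andbT addr0 ltr_pM2l.
under eq_integral do rewrite /gamma_pdf EFinM.
rewrite ge0_integralZl_EFin//; last 3 first.
- by move=> z _; rewrite lee_fin gker_ge0.
- apply/measurable_EFinP; apply: measurable_funTS.
  by apply: (measurableT_comp (measurable_gker s)); exact: measurable_funM.
- by rewrite divr_ge0 ?ltW// Gamma_gt0.
rewrite muleA -EFinM [b / _]mulrC; congr (_ * _)%E.
by under [RHS]eq_integral do rewrite addr0.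
Qed.

Lemma integral_gamma_pdfT b s : 0 < b -> 0 < s ->
  (\int[mu]_(z in `]0%R, +oo[) (gamma_pdf b s z)%:E = 1)%E.
Proof.
move=> b0 s0; rewrite integral_gamma_pdf// mulr0 -EFin_Gamma// -EFinM mulVf//.
by rewrite gt_eqF// Gamma_gt0.
Qed.

(** Exponential tilting of a gamma density only changes its rate, so the Laplace transform is the
    normalising factor. *)
Lemma gamma_pdfM b s k z : 0 < b -> 0 < s -> 0 <= k -> 0 < z ->
  gamma_pdf b s z * expR (- (k * z)) = (b / (b + k)) `^ s * gamma_pdf (b + k) s z.
Proof.
move=> b0 s0 k0 z0; have bk0 : 0 < b + k by rewrite ltr_wpDr.
have bs c : 0 < c -> c * c `^ (s - 1) = c `^ s.
  move=> c0; rewrite -{1}[c](powRr1 (ltW c0)) -powRD; last first.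
    by apply/implyP => _; exact: lt0r_neq0.
  by congr (_ `^ _); lra.
rewrite /gamma_pdf /gker !powRM ?(ltW b0) ?(ltW bk0) ?(ltW z0) ?invr_ge0 ?(ltW bk0)//.
have -> : expR (- ((b + k) * z)) = expR (- (b * z)) * expR (- (k * z)).
  by rewrite -expRD; congr expR; ring.
have -> : (b + k)^-1 `^ s = ((b + k) `^ s)^-1.
  by rewrite -powR_inv1 ?(ltW bk0)// -powRrM mulN1r powRN.
rewrite -(bs b b0) -(bs _ bk0); field.
by rewrite !gt_eqF ?powR_gt0 ?Gamma_gt0.
Qed.

Lemma integral_gamma_pdfM b s k : 0 < b -> 0 < s -> 0 <= k ->
  (\int[mu]_(z in `]0%R, +oo[) (gamma_pdf b s z * expR (- (k * z)))%:E =
   ((b / (b + k)) `^ s)%:E)%E.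
Proof.
move=> b0 s0 k0; have bk0 : 0 < b + k by rewrite ltr_wpDr.
under eq_integral.
  move=> z; rewrite inE /= in_itv /= andbT => z0.
  rewrite gamma_pdfM// EFinM; over.
rewrite ge0_integralZl_EFin//; last 3 first.
- by move=> z _; rewrite lee_fin gamma_pdf_ge0 ?ltW.
- by apply/measurable_EFinP; exact: measurable_gamma_pdf.
- exact: powR_ge0.
by rewrite integral_gamma_pdfT// mule1.
Qed.

End gamma_density.

Section gamma_law.
Context {R : realType} {d} {T : measurableType d} {P : probability T R}.
Notation mu := (@lebesgue_measure R).

Lemma gamma_law (X : {RV P >-> R}) (b s : R) : 0 < b -> 0 < s ->
  {ae P, forall w, 0 <= X w} ->
  (forall u, P (X @^-1` [set u]) = 0%E) ->
  (forall k : nat, 'E_P[fun w => expR (- (k%:R * X w))] = ((b / (b + k%:R)) `^ s)%:E)%E ->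
  forall u, 0 < u ->
  P [set w | u < X w]%R = (\int[mu]_(z in `]u, +oo[) (gamma_pdf b s z)%:E)%E.
Proof.
move=> b0 s0 X0 noatom mgf u u0.
pose D : set R := `]0, +oo[%classic.
(* [X] is nonnegative only almost surely; the truncation at 0 puts [Y1] in [0, 1] everywhere. It
   does not affect the event X > u, because u > 0. *)
pose Y1 w := expR (- Num.max (X w) 0).
pose Y2 z : R := expR (- Num.max z 0).
pose w2 : R -> R := gamma_pdf b s \_ D.
have mY2 : measurable_fun [set: R] Y2.
  by apply: (measurableT_comp measurable_expRN); exact: measurable_maxr.
have mY1 : measurable_fun [set: T] Y1 by apply: (measurableT_comp mY2).
have e01 (z : R) : 0 <= expR (- Num.max z 0) <= 1.
  by rewrite expR_ge0 -[leRHS]expR0 ler_expR oppr_le0 le_max lexx orbT.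
have w20 z : 0 <= w2 z by apply: restrict_ge0 => y _; rewrite gamma_pdf_ge0// ltW.
have mw2 : measurable_fun [set: R] w2.
  by apply/(measurable_restrictT _ (measurable_itv _)); exact: measurable_gamma_pdf.
have w2I (f : R -> R) :
    (\int[mu]_z (f z * w2 z)%:E = \int[mu]_(z in D) (f z * gamma_pdf b s z)%:E)%E.
  rewrite [RHS]integral_mkcond; apply: eq_integral => z _; rewrite /w2 !patchE.
  by case: ifP; rewrite ?mulr0.
have w2i : mu.-integrable [set: R] (EFin \o w2).
  apply/integrableP; split; first exact/measurable_EFinP.
  under eq_integral do rewrite /= ger0_norm// -[w2 _]mul1r.
  rewrite (w2I (fun=> 1)); under eq_integral do rewrite mul1r.
  by rewrite integral_gamma_pdfT// ltry.
have step (z : R) : (expR (- Num.max z 0) < expR (- u)) = (u < z).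
  by rewrite ltr_expR ltrN2 lt_max [u < 0]ltNge (ltW u0) orbF.
have stepE (z : R) : expR (- Num.max z 0) = expR (- u) -> z = u.
  move=> /expR_inj/oppr_inj; case: (leP z 0) => // z0 h.
  by move: u0; rewrite -h ltxx.
have mom1 (k : nat) : (\int[P]_t (Y1 t ^+ k * 1)%:E = ((b / (b + k%:R)) `^ s)%:E)%E.
  rewrite -mgf unlock; apply: ae_eq_integral => //.
  - by apply/measurable_EFinP; apply: measurable_funM => //; exact: measurable_funX.
  - apply/measurable_EFinP; apply: (measurableT_comp measurable_expRN).
    exact: measurable_funM.
  - case: X0 => N [mN N0 subN]; exists N; split => // t /= h; apply: subN => /= X0.
    by apply: h => _; rewrite mulr1 /Y1 max_l// -expRM_natl mulrN.
have mom2 (k : nat) : (\int[mu]_t (Y2 t ^+ k * w2 t)%:E = ((b / (b + k%:R)) `^ s)%:E)%E.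
  rewrite (w2I (fun t => Y2 t ^+ k)) -integral_gamma_pdfM//.
  apply: eq_integral => z; rewrite inE /D /= in_itv /= andbT => z0.
  by rewrite /Y2 max_l ?(ltW z0)// -expRM_natl mulrN mulrC.
have i1 : P.-integrable [set: T] (EFin \o (fun=> 1)).
  exact: finite_measure_integrable_cst.
have n1 : P [set t | Y1 t = expR (- u)] = 0%E.
  rewrite -[RHS](noatom u); congr (P _); apply/seteqP; split => t /=; first exact: stepE.
  by rewrite /Y1 => ->; rewrite max_l// ltW.
have n2 : mu [set t | Y2 t = expR (- u)] = 0%E.
  rewrite -[RHS](lebesgue_measure_set1 u); congr (mu _).
  apply/seteqP; split => t /=; first exact: stepE.
  by rewrite /Y2 => ->; rewrite max_l// ltW.
have := @integral_lt_unique _ _ _ _ _ P mu Y1 (fun=> 1) Y2 w2 (expR (- u)) mY1 (fun t => e01 (X t))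
  (fun=> ler01) i1 n1 mY2 e01 w20 w2i n2.
have mom (k : nat) : \int[P]_t (Y1 t ^+ k * 1) = \int[mu]_t (Y2 t ^+ k * w2 t).
  by rewrite /Rintegral mom1 mom2.
move=> /(_ mom); rewrite /Rintegral.
have mXu : measurable [set w | u < X w].
  rewrite (_ : mkset _ = X @^-1` `]u, +oo[); first exact: measurable_funPTI.
  by apply/seteqP; split => t; rewrite /= in_itv /= andbT.
have -> : (\int[P]_x ((Y1 x < expR (- u))%R%:R * 1)%:E = P [set w | (u < X w)%R])%E.
  rewrite -(setIT [set w | u < X w]) -integral_indic//; apply: eq_integral => t _.
  by rewrite step mulr1 indicE; congr ((nat_of_bool _)%:R%:E); apply/idP/idP; rewrite inE.
have -> : (\int[mu]_x ((Y2 x < expR (- u))%R%:R * w2 x)%:E =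
    \int[mu]_(z in `]u, +oo[) (gamma_pdf b s z)%:E)%E.
  rewrite [RHS]integral_mkcond; apply: eq_integral => z _.
  rewrite step patchE /w2 patchE; have [uz|uz] := ltP u z.
    by rewrite mul1r !mem_set//= /D /= in_itv /= andbT// (lt_trans u0).
  by rewrite mul0r memNset//= in_itv /= andbT; apply/negP; rewrite -leNgt.
move=> h; have := congr1 (@EFin R) h; rewrite !fineK//.
  by rewrite integral_gamma_pdf// -EFin_igamma ?mulr_gt0// ltW.
exact: fin_num_measure.
Qed.

End gamma_law.

Lemma ae_measure_eq {d} {T : measurableType d} {R : realType}
    (m : {measure set T -> \bar R}) (A B : set T) :
  measurable A -> measurable B -> {ae m, forall w, A w <-> B w} -> m A = m B.
Proof.
move=> mA mB [N [mN N0 subN]].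
have le C D : measurable C -> measurable D -> (forall w, ~ N w -> C w -> D w) -> (m C <= m D)%E.
  move=> mC mD CD; apply: (@le_trans _ _ (m (D `|` N))).
    apply: le_measure; rewrite ?inE//; first exact: measurableU.
    by move=> w Cw; have [Nw|Nw] := pselect (N w); [right|left; exact: CD].
  by apply: le_trans (measureU2 _ _ _) _ => //; rewrite -[leRHS]adde0 leeD2l//; move: N0 => /= ->.
have AB w : ~ N w -> (A w <-> B w) by move=> Nw; apply: contrapT => h; apply: Nw; exact: subN.
by apply/eqP; rewrite eq_le !le// => w /AB [].
Qed.

(** * Pointwise values of a continuous density *)

Section density_bounds.
Context {R : realType}.
Notation mu := (@lebesgue_measure R).
Variables (f : R -> R) (x : R).
Hypotheses (mf : measurable_fun [set: R] f) (f0 : forall z, 0 <= f z).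
Hypothesis (cf : {for x, continuous f}).

Let integral_cst_itv (C y : R) : x < y ->
  (\int[mu]_(z in `]x, y]) C%:E = (C * (y - x))%:E)%E.
Proof.
move=> xy; rewrite integral_cst//= lebesgue_measure_itv /= lte_fin xy.
by rewrite -EFinD -EFinM.
Qed.

Let mfy y : measurable_fun `]x, y] (fun z => (f z)%:E).
Proof. by apply/measurable_EFinP; exact: measurable_funTS. Qed.

Lemma integral_le_cst (C : R) : f x < C ->
  exists2 e, 0 < e & forall y, x < y -> y <= x + e ->
    (\int[mu]_(z in `]x, y]) (f z)%:E <= (C * (y - x))%:E)%E.
Proof.
move=> fC; have : \forall z \near x, f z < C by apply: (cvgr_lt (f x) cf).
move=> /nbhs_ballP[r /= r0 rf]; exists (r / 2); first exact: divr_gt0.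
move=> y xy yr; rewrite -integral_cst_itv//; apply: ge0_le_integral => //.
- by move=> z _; rewrite lee_fin.
- exact: mfy.
move=> z; rewrite /= in_itv /= => /andP[xz zy]; rewrite lee_fin ltW//; apply: rf.
rewrite /ball /= ltr0_norm ?subr_lt0// opprB; lra.
Qed.

Let integral_ge_cst (C : R) : 0 <= C -> C < f x ->
  exists2 e, 0 < e & forall y, x < y -> y <= x + e ->
    ((C * (y - x))%:E <= \int[mu]_(z in `]x, y]) (f z)%:E)%E.
Proof.
move=> C0 fC; have : \forall z \near x, C < f z by apply: (cvgr_gt (f x) cf).
move=> /nbhs_ballP[r /= r0 rf]; exists (r / 2); first exact: divr_gt0.
move=> y xy yr; rewrite -integral_cst_itv//; apply: ge0_le_integral => //.
  exact: mfy.
move=> z; rewrite /= in_itv /= => /andP[xz zy]; rewrite lee_fin ltW//; apply: rf.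
rewrite /ball /= ltr0_norm ?subr_lt0// opprB; lra.
Qed.

(** If [f x] exceeded [C], continuity would make the averages over short intervals to the right of
    [x] at least (C + f x)/2, which is larger than C. *)
Lemma density_le (C e : R) : 0 < e ->
  (forall y, x < y -> y <= x + e -> (\int[mu]_(z in `]x, y]) (f z)%:E <= (C * (y - x))%:E)%E) ->
  f x <= C.
Proof.
move=> e0 h; rewrite leNgt; apply/negP => Cf.
(* The upper bound of a nonnegative integral forces this; [integral_ge_cst] asks for a nonnegative
   constant, here the midpoint of C and f x. *)
have C0 : 0 <= C.
  have := h (x + e); rewrite ltrDl lerD2l e0 lexx => /(_ isT isT).
  rewrite [x + e - x]addrAC subrr add0r => /(le_trans _) h1.
  have : (0 <= (C * e)%:E)%E by apply: h1; apply: integral_ge0 => z _; rewrite lee_fin.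
  by rewrite lee_fin pmulr_lge0.
have [] := @integral_ge_cst ((C + f x) / 2); [by lra|by lra|] => e' e'0 h'.
have m0 : 0 < Num.min e e' by rewrite lt_min e0.
have xy : x < x + Num.min e e' by rewrite ltrDl.
have := le_trans (h' _ xy _) (h _ xy _); rewrite !lerD2l !ge_min !lexx orbT => /(_ isT isT).
by rewrite lee_fin [x + _ - x]addrAC subrr add0r ler_pM2r//; apply/negP; rewrite -ltNge; lra.
Qed.

Lemma density_ge (C e : R) : 0 < e ->
  (forall y, x < y -> y <= x + e -> ((C * (y - x))%:E <= \int[mu]_(z in `]x, y]) (f z)%:E)%E) ->
  C <= f x.
Proof.
move=> e0 h; rewrite leNgt; apply/negP => Cf.
have [] := @integral_le_cst ((C + f x) / 2); [by lra|] => e' e'0 h'.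
have m0 : 0 < Num.min e e' by rewrite lt_min e0.
have xy : x < x + Num.min e e' by rewrite ltrDl.
have := le_trans (h _ xy _) (h' _ xy _); rewrite !lerD2l !ge_min !lexx orbT => /(_ isT isT).
by rewrite lee_fin [x + _ - x]addrAC subrr add0r ler_pM2r//; apply/negP; rewrite -ltNge; lra.
Qed.

End density_bounds.

Lemma density_unique {R : realType} (f g : R -> R) (x : R) :
  measurable_fun [set: R] f -> (forall z, 0 <= f z) -> {for x, continuous f} ->
  measurable_fun [set: R] g -> (forall z, 0 <= g z) -> {for x, continuous g} ->
  (forall y, x < y -> (\int[lebesgue_measure]_(z in `]x, y]) (f z)%:E =
    \int[lebesgue_measure]_(z in `]x, y]) (g z)%:E)%E) ->
  f x = g x.
Proof.
move=> mf f0 cf mg g0 cg fg; apply/eqP; rewrite eq_le; apply/andP; split.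
  apply/ler_addgt0Pr => e e0.
  have [|e' e'0 h] := integral_le_cst mg g0 cg (C := g x + e); first by rewrite ltrDl.
  by apply: (density_le mf f0 cf e'0) => y xy ye; rewrite fg// h.
apply/ler_addgt0Pr => e e0.
have [|e' e'0 h] := integral_le_cst mf f0 cf (C := f x + e); first by rewrite ltrDl.
by apply: (density_le mg g0 cg e'0) => y xy ye; rewrite -fg// h.
Qed.

Section subordinator_law.
Context {R : realType} {a b : R} (a_gt0 : 0 < a) (b_gt0 : 0 < b).
Context {d : measure_display} {T : measurableType d} {P : probability T R}.
Context {H : R -> {RV P >-> R}} {h : R -> R -> R}.
Hypothesis H_gamma : is_gamma_subordinator a b H.
Hypothesis h_density : forall t, 0 < t -> is_density (law P (H t)) (h t).
Notation mu := (@lebesgue_measure R).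

Lemma subordinator_ge0 t : 0 <= t -> {ae P, forall w, 0 <= H t w}.
Proof.
move=> t0; have [H0 Hp _ _] := H_gamma.1.
by apply: filterS2 H0 Hp => w H0w [/(_ 0 t (lexx _) t0) + _]; rewrite H0w.
Qed.

Lemma subordinator_atomless t u : 0 < t -> P (H t @^-1` [set u]) = 0%E.
Proof.
move=> t0; have [_ _ hE _] := h_density t0.
by rewrite -[LHS]/(law P (H t) [set u]) hE//= integral_set1.
Qed.

Lemma subordinator_tail t u : 0 < t -> 0 < u ->
  P [set w | u < H t w]%R = (\int[mu]_(z in `]u, +oo[) (gamma_pdf b (a * t) z)%:E)%E.
Proof.
move=> t0 u0; apply: gamma_law => //.
- exact: mulr_gt0.
- by apply: subordinator_ge0; exact: ltW.
- by move=> v; exact: subordinator_atomless.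
move=> k; rewrite (H_gamma.2 t k%:R (ltW t0) (ler0n _ _)) /gamma_exponent.
have bk0 : 0 < b + k%:R by rewrite ltr_wpDr.
rewrite /powR gt_eqF ?divr_gt0//; congr (expR _)%:E.
rewrite mulrA -mulrN [t * a]mulrC -lnV ?posrE ?ltr_wpDr ?divr_ge0 ?(ltW b_gt0)//.
by congr (_ * ln _); field; rewrite !gt_eqF.
Qed.

Lemma subordinator_tailE t u : 0 < t -> 0 < u ->
  P [set w | u < H t w]%R = (igamma (a * t) (b * u) / Gamma (a * t))%:E.
Proof.
move=> t0 u0; rewrite subordinator_tail// integral_gamma_pdf ?mulr_gt0//.
by rewrite -EFin_igamma ?mulr_gt0 ?mulr_ge0 ?(ltW a_gt0) ?(ltW t0)// -EFinM mulrC.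
Qed.

Lemma measurable_tail t u : measurable [set w | u < H t w]%R.
Proof.
rewrite (_ : mkset _ = H t @^-1` `]u, +oo[); first exact: measurable_funPTI.
by apply/seteqP; split => w; rewrite /= in_itv /= andbT.
Qed.

Lemma subordinator_tail_le t u : 0 < t -> 0 < u ->
  P [set w | u <= H t w]%R = P [set w | u < H t w]%R.
Proof.
move=> t0 u0.
rewrite (_ : [set w | u <= H t w] = [set w | u < H t w] `|` (H t @^-1` [set u])); last first.
  apply/seteqP; split => w /=; first by rewrite le_eqVlt => /predU1P[->|]; [right|left].
  by move=> [/ltW//|->].
rewrite measureU//.
- by rewrite -[RHS]adde0; congr (_ + _)%E; exact: subordinator_atomless.
- exact: measurable_tail.
- by apply/seteqP; split => w //= -[] + e; rewrite e ltxx.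
Qed.

Lemma continuous_gamma_pdf s x : 0 < x -> {for x, continuous (gamma_pdf b s)}.
Proof.
move=> x0.
have bx0 : 0 < b * x by rewrite mulr_gt0.
apply: continuousM; first exact: cst_continuous.
apply: (@continuous_comp R R R (fun z => b * z) (gker s) x).
  by apply: continuousM; [exact: cst_continuous|exact: id].
apply: continuousM.
  apply: differentiable_continuous; apply/derivable1_diffP.
  by have [] := is_derive1_powR (s - 1) bx0.
apply: (@continuous_comp R R R (fun z => - z) (@expR R)); first exact: opp_continuous.
exact: continuous_expR.
Qed.

Lemma subordinator_density t x : 0 < t -> 0 < x -> h t x = gamma_pdf b (a * t) x.
Proof.
move=> t0 x0; have [mh h0 hE hc] := h_density t0.
have at0 : 0 < a * t by rewrite mulr_gt0.
have g0 z : 0 <= gamma_pdf b (a * t) z by rewrite gamma_pdf_ge0// ltW.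
have mg : measurable_fun [set: R] (gamma_pdf b (a * t)) by exact: measurable_gamma_pdf.
apply: (density_unique mh h0 _ mg g0); [exact: hc|exact: continuous_gamma_pdf|move=> y xy].
have y0 : 0 < y by exact: lt_trans xy.
rewrite -hE// /law.
(* The tails determine the integrals over ]x,y] by subtraction, since the tail beyond [y] is
   finite. *)
have e1 : (P [set w | x < H t w]%R = P (H t @^-1` `]x, y]) + P [set w | y < H t w]%R)%E.
  rewrite -measureU//.
  - congr (P _); apply/seteqP; split => w /=; rewrite in_itv /=.
      by move=> ->; case: (leP (H t w) y); [left|right].
    by move=> [/andP[]//|]; exact: lt_trans.
  - exact: measurable_funPTI.
  - exact: measurable_tail.
  - apply/seteqP; split => w //=; rewrite in_itv /= => -[/andP[_ h1] h2].
    by move: (lt_le_trans h2 h1); rewrite ltxx.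
have e2 : (\int[mu]_(z in `]x, +oo[) (gamma_pdf b (a * t) z)%:E =
    \int[mu]_(z in `]x, y]) (gamma_pdf b (a * t) z)%:E +
    \int[mu]_(z in `]y, +oo[) (gamma_pdf b (a * t) z)%:E)%E.
  rewrite -ge0_integral_setU//=.
  - congr (integral _ _ _); apply/seteqP; split => w /=; rewrite !in_itv /= !andbT.
      by move=> ->; case: (leP w y); [left|right].
    by move=> [/andP[]//|]; exact: lt_trans.
  - by apply/measurable_EFinP; exact: measurable_gamma_pdf.
  - by move=> z _; rewrite lee_fin.
  - apply/disj_setPS => w /=; rewrite !in_itv /= !andbT => -[/andP[_ h1] h2].
    by move: (lt_le_trans h2 h1); rewrite ltxx.
have fy : P [set w | y < H t w]%R \is a fin_num by apply: fin_num_measure; exact: measurable_tail.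
move: e1; rewrite (subordinator_tail t0 x0) e2 -(subordinator_tail t0 y0).
by move=> /(congr1 (fun z => z - P [set w | (y < H t w)%R])%E); rewrite !addeK.
Qed.

End subordinator_law.

(** * Independent increments and the convolution identity *)

Section convolution.
Context {R : realType} {a b : R} (a_gt0 : 0 < a) (b_gt0 : 0 < b).
Context {d : measure_display} {T : measurableType d} {P : probability T R}.
Context {H : R -> {RV P >-> R}} {h : R -> R -> R}.
Hypothesis H_gamma : is_gamma_subordinator a b H.
Hypothesis h_density : forall t, 0 < t -> is_density (law P (H t)) (h t).
Notation mu := (@lebesgue_measure R).

Lemma subordinator_gt0 t : 0 < t -> {ae P, forall w, 0 < H t w}.
Proof.
move=> t0; have ge0 := subordinator_ge0 H_gamma (ltW t0).
have ne0 : {ae P, forall w, H t w <> 0}.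
  exists (H t @^-1` [set 0]); split; first exact: measurable_funPTI.
    exact: (subordinator_atomless h_density).
  by move=> w /= /contrapT.
by apply: filterS2 ge0 ne0 => w h0 /eqP hn; rewrite lt0r hn.
Qed.

Let incr_law t e : 0 <= t -> 0 <= e -> forall A B : set R, measurable A -> measurable B ->
  P ((fun w => (H (t + e) w - H t w, H t w - H 0 w)) @^-1` (A `*` B)) =
  (distribution P (H e) A * distribution P (H t) B)%E.
Proof.
move=> t0 e0 A B mA mB.
have [_ _ st ind] := H_gamma.1.
(* Independence is used for the two increments over the times 0, t, t + e; the constant continuation
   keeps the sequence nondecreasing. *)
pose tt (n : nat) : R := match n with 0%N => 0 | 1%N => t | _ => t + e end.
pose AB (n : nat) : set R := if n is 0%N then B else A.
have := ind 2%N tt AB (lexx 0).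
have tti i : tt i <= tt i.+1 by case: i => [|[|i]] //=; rewrite lerDl.
have mAB i : measurable (AB i) by case: i.
move=> /(_ tti mAB); rewrite big_ord_recl big_ord1 /= => E.
have stB := st 0 t B (lexx 0) t0 mB; rewrite add0r in stB.
rewrite muleC /distribution /pushforward -stB -(st t e A t0 e0 mA) -E.
congr (P _); apply/seteqP; split => w /=.
  by move=> [hA hB] [|[|i]].
by move=> hw; split; [exact: (hw 1%N)|exact: (hw 0%N)].
Qed.

Lemma subordinator_convolution t e x : 0 < t -> 0 < e -> 0 < x ->
  (P [set w | (H t w < x)%R] = P [set w | (H (t + e) w < x)%R] +
   \int[mu]_(z in `]0%R, x[) ((gamma_pdf b (a * t) z)%:E * P [set w | (x - z < H e w)%R]))%E.
Proof.
move=> t0 e0 x0.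
have g0 z : 0 <= gamma_pdf b (a * t) z by rewrite gamma_pdf_ge0 ?mulr_gt0// ltW.
have mlt s : measurable [set w | (H s w < x)%R].
  rewrite (_ : mkset _ = H s @^-1` `]-oo, x[); first exact: measurable_funPTI.
  by apply/seteqP; split => w; rewrite /= in_itv.
(* The event that the path passes level [x] between the times t and t + e. *)
pose E' := [set w | (0 < H t w < x) && (x <= H (t + e) w)].
(* Independence concerns H t - H 0, and H 0 vanishes only almost surely; [step2] exchanges this
   increment for H t. *)
pose phi w := (H (t + e) w - H t w, H t w - H 0 w) : R * R.
pose c (p : R * R) := [&& 0 < p.2, p.2 < x & x <= p.2 + p.1].
have mphi : measurable_fun [set: T] phi.
  by apply/measurable_fun_pair; apply: measurable_funB.
have mc : measurable_fun [set: R * R] c.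
  apply: measurable_and; first exact: measurable_fun_ltr.
  apply: measurable_and; first exact: measurable_fun_ltr.
  by apply: measurable_fun_ler => //; exact: measurable_funD.
pose S := c @^-1` [set true].
have mS : measurable S by rewrite -[X in measurable X]setTI; exact: mc.
have mE' : measurable E'.
  rewrite (_ : E' = (fun w => (H (t + e) w - H t w, H t w) : R * R) @^-1` S).
    rewrite -[X in measurable X]setTI.
    have mp : measurable_fun [set: T] (fun w => (H (t + e) w - H t w, H t w) : R * R).
      by apply/measurable_fun_pair => //; apply: measurable_funB.
    exact: mp.
  by apply/seteqP; split => w; rewrite /E' /S /c /= subrKC -andbA.
have mE : measurable (phi @^-1` S) by rewrite -[X in measurable X]setTI; exact: mphi.
have step1 : P [set w | (H t w < x)%R] = (P [set w | (H (t + e) w < x)%R] + P E')%E.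
  rewrite -measureU//; last first.
    by apply/seteqP; split => w //= [] + /andP[_ h1]; rewrite ltNge h1.
  apply: ae_measure_eq => //; first exact: measurableU.
  have [_ Hp _ _] := H_gamma.1.
  have tpos := subordinator_gt0 t0.
  apply: filterS2 Hp tpos => w [mono _] H0; have := mono t (t + e) (ltW t0).
  rewrite lerDl (ltW e0) => /(_ isT) hm; rewrite /E' /= H0 /=.
  split => [h1|[h1|/andP[]//]]; last exact: le_lt_trans h1.
  by rewrite h1 /=; case: ltP => _; [left|right].
have step2 : P E' = P (phi @^-1` S).
  apply: ae_measure_eq => //.
  have [H0 _ _ _] := H_gamma.1.
  apply: filterS H0 => w H0w; by rewrite /E' /S /c /phi /= H0w subr0 subrKC -andbA.
pose m1 := distribution P (H e); pose m2 := distribution P (H t).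
pose m' : {measure set (R * R) -> \bar R} :=
  measure_function_pushforward__canonical__measure_function_Measure P mphi.
(* Both measures agree on rectangles, so the joint law of the two increments is the product of the
   laws of H e and H t. *)
have step3 : P (phi @^-1` S) = (m1 \x m2)%E S.
  apply/esym; apply: (@product_measure_unique _ _ _ _ _ m1 m2 m') => // A B mA mB.
  exact: (incr_law (ltW t0) (ltW e0) mA mB).
pose f (p : R * R) := if c p then (gamma_pdf b (a * t) p.2)%:E else 0%E.
have mf : measurable_fun [set: R * R] f.
  apply: measurable_fun_ifT => //; apply/measurable_EFinP.
  by apply: (measurableT_comp (measurable_gamma_pdf b (a * t) (D := setT))).
have f0 p : (0 <= f p)%E by rewrite /f; case: ifP => // _; rewrite lee_fin.
have step4 : (m1 \x m2)%E S = (\int[m1]_y \int[mu]_z f (y, z))%E.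
  rewrite /product_measure1; apply: eq_integral => y _.
  have mx : measurable (xsection S y) by exact: measurable_xsection.
  have [_ _ hE _] := h_density t0.
  rewrite /= -[LHS]/(law P (H t) (xsection S y)) hE// integral_mkcond.
  apply: eq_integral => z _; rewrite patchE /f.
  have -> : (z \in xsection S y) = c (y, z) by rewrite mem_xsection; apply/idP/idP; rewrite inE.
  case: ifP => // /and3P[z0 _ _]; congr EFin.
  exact: (subordinator_density a_gt0 b_gt0 H_gamma h_density).
rewrite step1 step2 step3 step4; congr (_ + _)%E.
(* With the order exchanged the inner integral over the law of H e is P(x - z <= H e), and
   strictness is immaterial since H e has no atoms. *)
rewrite (fubini_tonelli (m1 := m1) (m2 := mu) f mf f0).
rewrite [RHS]integral_mkcond; apply: eq_integral => z _; rewrite patchE.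
case: ifPn => [|zn]; last first.
  apply: integral0_eq => y _; rewrite /f /c /=; case: ifPn => // /and3P[z0 zx _].
  by move: zn; rewrite notin_setE /= in_itv /= z0 zx.
rewrite inE /= in_itv /= => /andP[z0 zx].
rewrite -(subordinator_tail_le h_density) ?subr_gt0//.
rewrite /f /c /= z0 zx /= (integral_if m1 [set y | x <= z + y]) => //.
rewrite integral_cst; last first.
  rewrite (_ : mkset _ = `[x - z, +oo[%classic); first exact: measurable_itv.
  by apply/seteqP; split => y; rewrite /= in_itv /= andbT lerBlDl.
congr (_ * P _)%E; apply/seteqP; split => w /=; by rewrite lerBlDl.
Qed.

End convolution.

(** * The potential density *)

Section potential.
Context {R : realType} {a b : R} (a_gt0 : 0 < a) (b_gt0 : 0 < b).
Notation mu := (@lebesgue_measure R).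

(** The potential density with the explicit gamma density in place of [h]. The function [h t] is
    given for each t separately, with no measurability in t, whereas Tonelli requires joint
    measurability. *)
Definition kappa (x : R) : \bar R :=
  (\int[mu]_(t in `]0%R, +oo[) (gamma_pdf b (a * t) x)%:E)%E.

Let G (p : R * R) : \bar R :=
  if (0 < p.1) && (0 < p.2) then (gamma_pdf b (a * p.1) p.2)%:E else 0%E.

Let gamma_pdf_pos t x : 0 < t -> 0 <= gamma_pdf b (a * t) x.
Proof. by move=> t0; rewrite gamma_pdf_ge0 ?mulr_gt0// ltW. Qed.

Let G_ge0 p : (0 <= G p)%E.
Proof. by rewrite /G; case: ifP => // /andP[p0 _]; rewrite lee_fin gamma_pdf_pos. Qed.

Let measurable_G : measurable_fun [set: R * R] G.
Proof.
pose G' (p : R * R) : \bar R := if (0 < p.1) && (0 < p.2) then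
  (b * (Gamma (a * p.1))^-1 * expR ((a * p.1 - 1) * ln (b * p.2) - b * p.2))%:E else 0%E.
have -> : G = G'.
  apply/funext => -[t z]; rewrite /G /G' /=; case: ifP => // /andP[t0 z0].
  have bz0 : 0 < b * z by rewrite mulr_gt0.
  by rewrite /gamma_pdf gkerE.
have m1 : measurable_fun [set: R * R] (fun p => a * p.1) by exact: measurable_funM.
have m2 : measurable_fun [set: R * R] (fun p => b * p.2) by exact: measurable_funM.
apply: measurable_fun_ifT => //.
  by apply: measurable_and; exact: measurable_fun_ltr.
apply/measurable_EFinP; apply: measurable_funM.
  apply: measurable_funM => //.
  exact: (measurableT_comp (@measurable_Gamma_inv R)).
apply: measurableT_comp => //; apply: measurable_funB => //; apply: measurable_funM.
  exact: measurable_funB.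
exact: (measurableT_comp (@measurable_ln R)).
Qed.

Lemma kappa_ge0 x : (0 <= kappa x)%E.
Proof.
by apply: integral_ge0 => t; rewrite /= in_itv /= andbT => t0; rewrite lee_fin gamma_pdf_pos.
Qed.

Lemma measurable_kappa (x : R) : measurable_fun `]0, x[ kappa.
Proof.
have := measurable_fun_fubini_tonelli_G (m1 := mu) _ measurable_G G_ge0.
move=> /(measurable_funS (E := setT) (D := (`]0, x[ : set R)) measurableT (@subsetT _ _)).
apply: eq_measurable_fun => z; rewrite inE /= in_itv /= => /andP[z0 _].
rewrite /fubini_G /G /= z0 /kappa [RHS]integral_mkcond; apply: eq_integral => t _.
by rewrite patchE mem_setE in_itv /= !andbT.
Qed.

Lemma measurable_gamma_pdf_param (z : R) : 0 < z ->
  measurable_fun (`]0, +oo[ : set R) (fun t => (gamma_pdf b (a * t) z)%:E).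
Proof.
move=> z0.
have m : measurable_fun [set: R] (fun t => (t, z) : R * R) by exact: measurable_fun_pair.
apply: (eq_measurable_fun (fun t => G (t, z))).
  by move=> t; rewrite inE /= in_itv /= andbT /G /= z0 andbT => ->.
by apply: measurable_funTS; exact: (measurableT_comp measurable_G m).
Qed.

Let F (x : R) (q : R -> R) (p : R * R) : \bar R :=
  (G p * (if p.2 < x then q p.2 else 0)%:E)%E.

Let measurable_F x q : measurable_fun [set: R] q -> measurable_fun [set: R * R] (F x q).
Proof.
move=> mq; apply: emeasurable_funM => //; apply/measurable_EFinP; apply: measurable_fun_ifT => //.
  exact: measurable_fun_ltr.
exact: (measurableT_comp mq).
Qed.

Let F_ge0 x q p : (forall z, 0 <= q z) -> (0 <= F x q p)%E.
Proof. by move=> q0; rewrite mule_ge0// lee_fin; case: ifP. Qed.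

Let integral_F x q t : 0 < t ->
  (\int[mu]_z F x q (t, z) =
   \int[mu]_(z in `]0%R, x[) ((gamma_pdf b (a * t) z)%:E * (q z)%:E))%E.
Proof.
move=> t0; rewrite [RHS]integral_mkcond; apply: eq_integral => z _.
rewrite patchE mem_setE in_itv /= /F /G /= t0 /=.
by case: (0 < z) => /=; [case: (z < x); rewrite ?mule0|rewrite mul0e].
Qed.

Lemma measurable_integral_gamma_pdf (x : R) (q : R -> R) :
  measurable_fun [set: R] q -> (forall z, 0 <= q z) ->
  measurable_fun (`]0, +oo[ : set R)
    (fun t => \int[mu]_(z in `]0%R, x[) ((gamma_pdf b (a * t) z)%:E * (q z)%:E))%E.
Proof.
move=> mq q0.
have := measurable_fun_fubini_tonelli_F (m2 := mu) _ (measurable_F x mq) (fun p => F_ge0 x p q0).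
move=> /(measurable_funS (E := setT) (D := (`]0, +oo[ : set R)) measurableT (@subsetT _ _)).
apply: eq_measurable_fun => t; rewrite inE /= in_itv /= andbT => t0.
by rewrite -integral_F.
Qed.

Lemma integral_kappa (x : R) (q : R -> R) : measurable_fun [set: R] q -> (forall z, 0 <= q z) ->
  (\int[mu]_(z in `]0%R, x[) (kappa z * (q z)%:E) =
   \int[mu]_(t in `]0%R, +oo[) \int[mu]_(z in `]0%R, x[) ((gamma_pdf b (a * t) z)%:E * (q z)%:E))%E.
Proof.
move=> mq q0.
have := fubini_tonelli (m1 := mu) (m2 := mu) _ (measurable_F x mq) (fun p => F_ge0 x p q0).
have -> : (\int[mu]_t \int[mu]_z F x q (t, z) = \int[mu]_(t in `]0%R, +oo[)
    \int[mu]_(z in `]0%R, x[) ((gamma_pdf b (a * t) z)%:E * (q z)%:E))%E.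
  rewrite [RHS]integral_mkcond; apply: eq_integral => t _.
  rewrite patchE mem_setE in_itv /= andbT; case: ifPn => [t0|t0].
    exact: integral_F.
  by apply: integral0_eq => z _; rewrite /F /G /= (negbTE t0) mul0e.
move=> ->; rewrite [LHS]integral_mkcond; apply: eq_integral => z _.
rewrite patchE mem_setE in_itv /=; case: ifPn => [/andP[z0 zx]|zn]; last first.
  apply/esym; apply: integral0_eq => t _; rewrite /F /G /=.
  by move: zn; case: (0 < z); case: (z < x); rewrite ?andbF ?mul0e ?mule0.
rewrite /F /G /= z0 zx muleC -ge0_integralZl_EFin//; last 2 first.
- by move=> t; rewrite /= in_itv /= andbT => t0; rewrite lee_fin gamma_pdf_pos.
- exact: measurable_gamma_pdf_param.
rewrite [LHS]integral_mkcond; apply: eq_integral => t _.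
rewrite patchE mem_setE in_itv /= !andbT; case: ifP => _; first by rewrite muleC.
by rewrite mul0e.
Qed.

(** For z < x one has 1 <= e^x e^(-z), so the mass of each gamma density on ]0,x[ is at most e^x
    times its Laplace transform at 1, which decays exponentially in t. *)
Lemma integral_kappa_lty (x : R) : (\int[mu]_(z in `]0%R, x[) kappa z < +oo)%E.
Proof.
have := @integral_kappa x (fun=> 1) (measurable_cst _) (fun=> ler01).
under eq_integral do rewrite mule1.
move=> ->.
pose r := b / (b + 1).
have b10 : 0 < b + 1 by rewrite addr_gt0.
have r0 : 0 < r by rewrite divr_gt0.
have r1 : r < 1 by rewrite ltr_pdivrMr// mul1r ltrDl.
(* This is Phi(1) = a ln(1 + 1/b). *)
pose c := - (a * ln r).
have c0 : 0 < c by rewrite /c -mulrN mulr_gt0// oppr_gt0 ln_lt0// r0.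
have mE : measurable_fun [set: R] (fun t => (expR (- (c * t)))%:E).
  apply/measurable_EFinP; apply: (measurableT_comp measurable_expRN).
  exact: measurable_funM.
apply: (@le_lt_trans _ _ (\int[mu]_(t in `]0%R, +oo[) ((expR x)%:E * (expR (- (c * t)))%:E))%E).
  apply: ge0_le_integral => //.
  - by move=> t; rewrite /= in_itv /= andbT => t0; apply: integral_ge0 => z _;
      rewrite mule1 lee_fin gamma_pdf_pos.
  - have := @measurable_integral_gamma_pdf x (fun=> 1) (measurable_cst _) (fun=> ler01).
    apply: eq_measurable_fun => t _; exact: eq_integral.
  - by apply: measurable_funTS; exact: measurable_funeM.
  - move=> t; rewrite /= in_itv /= andbT => t0.
    have at0 : 0 < a * t by rewrite mulr_gt0.
    have -> : expR (- (c * t)) = r `^ (a * t).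
      by rewrite /powR gt_eqF// /c; congr expR; ring.
    rewrite /r -integral_gamma_pdfM// -ge0_integralZl_EFin ?expR_ge0//; last 2 first.
    + by move=> z _; rewrite lee_fin mulr_ge0 ?gamma_pdf_pos ?expR_ge0.
    + apply/measurable_EFinP; apply: measurable_funM; first exact: measurable_gamma_pdf.
      apply: measurable_funTS; apply: (measurableT_comp measurable_expRN).
      exact: measurable_funM.
    apply: (@le_trans _ _ (\int[mu]_(z in `]0%R, x[)
        ((expR x)%:E * (gamma_pdf b (a * t) z * expR (- (1 * z)))%:E))%E).
      apply: ge0_le_integral => //.
      * by move=> z _; rewrite mule1 lee_fin gamma_pdf_pos.
      * apply: emeasurable_funM; last exact: measurable_cst.
        by apply/measurable_EFinP; exact: measurable_gamma_pdf.
      * apply: measurable_funeM; apply/measurable_EFinP.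
        apply: measurable_funM; first exact: measurable_gamma_pdf.
        apply: measurable_funTS; apply: (measurableT_comp measurable_expRN).
        exact: measurable_funM.
      * move=> z; rewrite /= in_itv /= => /andP[_ zx].
        rewrite mule1 -EFinM lee_fin mul1r mulrCA ler_peMr ?gamma_pdf_pos// -expRD.
        by rewrite -[leLHS]expR0 ler_expR subr_ge0 ltW.
    apply: ge0_subset_integral => //.
    + apply: measurable_funeM; apply/measurable_EFinP.
      apply: measurable_funM; first exact: measurable_gamma_pdf.
      apply: measurable_funTS; apply: (measurableT_comp measurable_expRN).
      exact: measurable_funM.
    + by move=> z _; rewrite -EFinM lee_fin mulr_ge0 ?expR_ge0// mulr_ge0 ?expR_ge0 ?gamma_pdf_pos.
    + by apply: subset_itvl; rewrite bnd_simp.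
rewrite ge0_integralZl_EFin ?expR_ge0//; last exact: measurable_funTS.
have E : (c%:E * \int[mu]_(t in `]0%R, +oo[) (expR (- (c * t)))%:E = 1)%E.
  have := integral_expRN (0 : R); rewrite oppr0 expR0 => <-.
  rewrite [RHS](@ge0_integral_affine R c 0 `]0, +oo[)//; last first.
    by apply/measurable_EFinP; apply: measurable_funTS; exact: measurable_expRN.
  have -> : (fun x => c * x + 0) @^-1` `]0, +oo[ = `]0, +oo[%classic.
    by apply/seteqP; split => z; rewrite /= !in_itv /= !andbT addr0 pmulr_rgt0.
  by under [in RHS]eq_integral do rewrite addr0.
rewrite (_ : integral _ _ _ = (c^-1)%:E) ?ltry//.
move: E; set I := integral _ _ _ => E.
by rewrite -[I]mul1e -(mulVf (lt0r_neq0 c0)) EFinM -muleA E mule1.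
Qed.

(** The integral behind nu(x, -1), kept in the extended reals: [nu] would take a default value if it
    were infinite. *)
Let N (x : R) : \bar R := (\int[mu]_(y in `]0%R, +oo[) (x `^ (y - 1) / Gamma y)%:E)%E.

(** The substitution y = a t, which produces the factor 1/a. *)
Lemma kappaE (x : R) : 0 < x -> kappa x = ((b / a * expR (- (b * x)))%:E * N (b * x))%E.
Proof.
move=> x0; have bx0 : 0 < b * x by rewrite mulr_gt0.
have mN : measurable_fun [set: R] (fun y => (b * x) `^ (y - 1) / Gamma y).
  apply: measurable_funM; last exact: measurable_Gamma_inv.
  apply: (measurableT_comp (measurable_powRr (b * x))); exact: measurable_funB.
rewrite /N (@ge0_integral_affine R a 0 `]0, +oo[)//; last 2 first.
- by apply/measurable_EFinP; exact: measurable_funTS.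
- move=> y; rewrite /= in_itv /= andbT => y0.
  by rewrite lee_fin divr_ge0 ?powR_ge0// ltW// Gamma_gt0.
have -> : (fun x => a * x + 0) @^-1` `]0, +oo[ = `]0, +oo[%classic.
  by apply/seteqP; split => z; rewrite /= !in_itv /= !andbT addr0 pmulr_rgt0.
rewrite muleA -EFinM -ge0_integralZl_EFin; last 4 first.
- exact: measurable_itv.
- move=> y; rewrite /= in_itv /= andbT => y0.
  by rewrite lee_fin divr_ge0 ?powR_ge0// addr0 ltW// Gamma_gt0// mulr_gt0.
- apply/measurable_EFinP; apply: measurable_funTS; apply: (measurableT_comp mN).
  by apply: measurable_funD => //; exact: measurable_funM.
- by rewrite !mulr_ge0 ?expR_ge0 ?invr_ge0 ?ltW.
apply: eq_integral => t; rewrite inE /= in_itv /= andbT => t0.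
rewrite -EFinM addr0 /gamma_pdf /gker; congr EFin; field.
by rewrite !gt_eqF ?Gamma_gt0 ?mulr_gt0.
Qed.

(** A Harnack-type inequality. As z^s increases with z, moving from z back to x costs at most z/x <=
    (x+1)/x and e^(b(z-x)) <= e^b. The constant does not depend on [s], so the bound can be
    integrated over t. *)
Let gamma_pdf_le s (x z : R) : 0 < s -> 0 < x -> x <= z -> z <= x + 1 ->
  gamma_pdf b s x <= (x + 1) / x * expR b * gamma_pdf b s z.
Proof.
move=> s0 x0 xz zx; have z0 : 0 < z by exact: lt_le_trans xz.
have x10 : 0 < x + 1 by rewrite addr_gt0.
rewrite /gamma_pdf /gker !powRM ?(ltW b_gt0) ?(ltW x0) ?(ltW z0)//.
have e y : 0 < y -> y `^ (s - 1) = y^-1 * y `^ s.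
  move=> y0; rewrite addrC powRD; last by apply/implyP => _; exact: lt0r_neq0.
  by rewrite powR_inv1 ?(ltW y0)//.
rewrite (e x x0) (e z z0).
set c := b / Gamma s; set p := b `^ (s - 1).
have cp : 0 <= c * p * x^-1.
  by rewrite !mulr_ge0 ?powR_ge0 ?invr_ge0 ?(ltW x0) ?(ltW b_gt0) ?(ltW (Gamma_gt0 s0)).
have -> : c * (p * (x^-1 * x `^ s) * expR (- (b * x))) =
  c * p * x^-1 * (x `^ s * expR (- (b * x))) by ring.
have -> : (x + 1) / x * expR b * (c * (p * (z^-1 * z `^ s) * expR (- (b * z)))) =
  c * p * x^-1 * (z `^ s * (expR b * expR (- (b * z)) * ((x + 1) / z))) by ring.
apply: ler_wpM2l => //; apply: ler_pM; rewrite ?powR_ge0 ?expR_ge0//.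
  by apply: (ge0_ler_powR (ltW s0)); rewrite ?nnegrE ?(ltW x0) ?(ltW z0).
rewrite -expRD -[leLHS]mulr1; apply: ler_pM => //; rewrite ?expR_ge0//.
  have : 0 <= b * (x + 1 - z) by rewrite mulr_ge0 ?subr_ge0// ltW.
  by rewrite ler_expR; nra.
by rewrite ler_pdivlMr// mul1r.
Qed.

(** On [x, x+1[, an interval of length 1, kappa z is at least kappa x / D; so kappa x is at most D
    times the finite mass of kappa on ]0, x+1[. *)
Lemma kappa_lty (x : R) : 0 < x -> (kappa x < +oo)%E.
Proof.
move=> x0; have x10 : 0 < x + 1 by rewrite addr_gt0.
pose D := (x + 1) / x * expR b.
have D0 : 0 <= D by rewrite !mulr_ge0 ?invr_ge0 ?expR_ge0 ?ltW.
have mk : measurable_fun (`[x, (x + 1)[ : set R) kappa.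
  apply: (measurable_funS _ _ (measurable_kappa (x := x + 1))) => //.
  by apply: subset_itvr; rewrite bnd_simp.
have kD z : x <= z -> z < x + 1 -> (kappa x <= D%:E * kappa z)%E.
  move=> xz zx; have z0 : 0 < z by exact: lt_le_trans xz.
  rewrite -ge0_integralZl_EFin//; last 2 first.
  - by move=> t; rewrite /= in_itv /= andbT => t0; rewrite lee_fin gamma_pdf_pos.
  - exact: measurable_gamma_pdf_param.
  apply: ge0_le_integral => //.
  - by move=> t; rewrite /= in_itv /= andbT => t0; rewrite lee_fin gamma_pdf_pos.
  - exact: measurable_gamma_pdf_param.
  - by apply: measurable_funeM; exact: measurable_gamma_pdf_param.
  - move=> t; rewrite /= in_itv /= andbT => t0.
    by rewrite -EFinM lee_fin gamma_pdf_le ?mulr_gt0// ltW.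
apply: (@le_lt_trans _ _ (D%:E * \int[mu]_(z in `]0%R, (x + 1)%R[) kappa z)%E); last first.
  by rewrite lte_mul_pinfty// ?lee_fin// integral_kappa_lty.
apply: (@le_trans _ _ (D%:E * \int[mu]_(z in `[x, (x + 1)%R[) kappa z)%E); last first.
  rewrite lee_wpmul2l ?lee_fin//; apply: ge0_subset_integral => //.
  - exact: measurable_kappa.
  - by move=> z _; exact: kappa_ge0.
  - by apply: subset_itvr; rewrite bnd_simp.
rewrite -ge0_integralZl_EFin//; last by move=> z _; exact: kappa_ge0.
have -> : kappa x = (\int[mu]_(z in `[x, (x + 1)%R[) kappa x)%E.
  rewrite integral_cst//= lebesgue_measure_itv /= lte_fin ltrDl ltr01.
  by rewrite -EFinD addrAC subrr add0r mule1.
apply: ge0_le_integral => //.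
- by move=> z _; exact: kappa_ge0.
- exact: measurable_funeM.
- by move=> z; rewrite /= in_itv /= => /andP[]; exact: kD.
Qed.

Lemma kappa_nu (x : R) : 0 < x ->
  kappa x = (b / a * expR (- (b * x)) * nu (b * x) (- 1))%:E.
Proof.
move=> x0; have := kappa_lty x0; rewrite kappaE// => klt.
have C0 : 0 < b / a * expR (- (b * x)) by rewrite !mulr_gt0 ?invr_gt0 ?expR_gt0.
rewrite [RHS]EFinM; congr (_ * _)%E.
have -> : nu (b * x) (- 1) = fine (N (b * x)).
  apply: eq_Rintegral => y; rewrite inE /= in_itv /= andbT => y0.
  by rewrite addrC subrK /recip_Gamma y0.
rewrite fineK// ge0_fin_numE; last first.
  apply: integral_ge0 => y; rewrite /= in_itv /= andbT => y0.
  by rewrite lee_fin divr_ge0 ?powR_ge0// ltW// Gamma_gt0.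
move: klt; rewrite !ltey; apply: contra => /eqP ->.
by rewrite gt0_muley ?lte_fin.
Qed.

End potential.
Arguments kappa {R} a b x.

(** * The Sonine identity *)

Section sonine.
Context {R : realType} {a b : R} (a_gt0 : 0 < a) (b_gt0 : 0 < b).
Context {d : measure_display} {T : measurableType d} {P : probability T R}.
Context {H : R -> {RV P >-> R}} {h : R -> R -> R}.
Hypothesis H_gamma : is_gamma_subordinator a b H.
Hypothesis h_density : forall t, 0 < t -> is_density (law P (H t)) (h t).
Notation mu := (@lebesgue_measure R).
Variables (x : R) (x_gt0 : 0 < x).

Let U t : \bar R := P [set w | (H t w < x)%R].
Let q s z := igamma s (b * (x - z)).

Let measurable_q s : measurable_fun [set: R] (q s).
Proof.
pose f (p : R * R) : \bar R := if b * (x - p.1) < p.2 then (gker s p.2)%:E else 0%E.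
have mf : measurable_fun [set: R * R] f.
  apply: measurable_fun_ifT => //.
    by apply: measurable_fun_ltr => //; apply: measurable_funM => //; exact: measurable_funB.
  apply/measurable_EFinP; exact: (measurableT_comp (measurable_gker s)).
have f0 p : (0 <= f p)%E by rewrite /f; case: ifP => // _; rewrite lee_fin gker_ge0.
have := measurable_fun_fubini_tonelli_F (m2 := mu) _ mf f0.
move=> /(measurableT_comp (@fine_measurable R _ measurableT)).
apply: eq_measurable_fun => z _ /=; rewrite /fubini_F /q /igamma /Rintegral; congr fine.
by rewrite (integral_if mu `]b * (x - z), +oo[)// => w; rewrite /= in_itv /= andbT.
Qed.

Let q_ge0 s z : 0 <= q s z. Proof. exact: igamma_ge0. Qed.

Let measurable_lt t : measurable [set w | (H t w < x)%R].
Proof.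
rewrite (_ : mkset _ = H t @^-1` `]-oo, x[); first exact: measurable_funPTI.
by apply/seteqP; split => w; rewrite /= in_itv.
Qed.

Let UE t : 0 < t ->
  U t = (\int[mu]_(z in `]0%R, x[) ((gamma_pdf b (a * t) z)%:E * 1%:E))%E.
Proof.
move=> t0; have [_ _ hE _] := h_density t0.
transitivity (law P (H t) `]0, x[).
  apply: ae_measure_eq => //; first exact: measurable_funPTI.
  apply: filterS (subordinator_gt0 H_gamma h_density t0) => w w0.
  by rewrite /= in_itv /= w0.
rewrite hE//; apply: eq_integral => z; rewrite inE /= in_itv /= => /andP[z0 _].
by rewrite mule1 (subordinator_density a_gt0 b_gt0 H_gamma h_density).
Qed.

Let measurable_U : measurable_fun (`]0, +oo[ : set R) U.
Proof.
have := measurable_integral_gamma_pdf a_gt0 b_gt0 x (measurable_cst (1 : R)) (fun=> ler01).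
by apply: eq_measurable_fun => t; rewrite inE /= in_itv /= andbT => t0; rewrite UE.
Qed.

Let integral_U : (\int[mu]_(t in `]0%R, +oo[) U t = \int[mu]_(z in `]0%R, x[) kappa a b z)%E.
Proof.
have := @integral_kappa R a b a_gt0 b_gt0 x (fun=> 1) (measurable_cst _) (fun=> ler01).
under eq_integral do rewrite mule1.
move=> ->; apply: eq_integral => t; rewrite inE /= in_itv /= andbT => t0.
by rewrite UE.
Qed.

Let U_ge0 t : (0 <= U t)%E. Proof. exact: measure_ge0. Qed.

Let U_le1 t : (U t <= 1)%E. Proof. exact: probability_le1. Qed.

(** For s = a e, division by Gamma(s) turns [q s z] into P(H_e > x - z), and [J s] into the integral
    of kappa against this tail. *)
Let J s : \bar R := (\int[mu]_(z in `]0%R, x[) (kappa a b z * (q s z)%:E))%E.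

(* Integrating the convolution identity over all [t > 0] telescopes *)
Lemma integral_kappa_igamma e : 0 < e ->
  ((Gamma (a * e))^-1%:E * J (a * e) = \int[mu]_(t in `]0%R, e]) U t)%E.
Proof.
move=> e0; have ae0 : 0 < a * e by rewrite mulr_gt0.
have G0 : 0 <= (Gamma (a * e))^-1 by rewrite invr_ge0 ltW// Gamma_gt0.
pose V t := (\int[mu]_(z in `]0%R, x[) ((gamma_pdf b (a * t) z)%:E * (q (a * e) z)%:E))%E.
have V0 t : 0 < t -> (0 <= V t)%E.
  move=> t0; apply: integral_ge0 => z _.
  by rewrite mule_ge0 ?lee_fin ?q_ge0// gamma_pdf_ge0 ?mulr_gt0// ltW.
have mV : measurable_fun (`]0, +oo[ : set R) V by exact: measurable_integral_gamma_pdf.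
have conv t : 0 < t -> U t = (U (t + e) + (Gamma (a * e))^-1%:E * V t)%E.
  move=> t0; rewrite [LHS](subordinator_convolution a_gt0 b_gt0 H_gamma h_density t0 e0 x_gt0).
  congr (_ + _)%E; rewrite -ge0_integralZl_EFin//; last 2 first.
  - move=> z _.
    by rewrite mule_ge0 ?lee_fin ?q_ge0// gamma_pdf_ge0 ?mulr_gt0// ltW.
  - apply: emeasurable_funM; first by apply/measurable_EFinP; exact: measurable_gamma_pdf.
    by apply/measurable_EFinP; apply: measurable_funTS; exact: measurable_q.
  apply: eq_integral => z; rewrite inE /= in_itv /= => /andP[z0 zx].
  rewrite (subordinator_tailE a_gt0 b_gt0 H_gamma h_density) ?subr_gt0//.
  by rewrite -!EFinM; congr EFin; rewrite /q; ring.
(* [U] is known to be measurable on the positive axis only; the extension by 0 is measurable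
   everywhere and can be composed with the shift by [e]. *)
pose U' : R -> \bar R := U \_ `]0, +oo[.
have mU' : measurable_fun [set: R] U' by apply/(measurable_restrictT _ (measurable_itv _)).
have U'0 t : (0 <= U' t)%E by rewrite /U' patchE; case: ifP.
have U'E t : 0 < t -> U' t = U t.
  by move=> t0; rewrite /U' patchE mem_setE in_itv /= t0.
have W1 : (\int[mu]_(t in `]0%R, +oo[) U t =
    \int[mu]_(t in `]e, +oo[) U' t + (Gamma (a * e))^-1%:E * J (a * e))%E.
  rewrite (@ge0_integral_affine R 1 e `]e, +oo[)//; last exact: measurable_funTS.
  have -> : (fun x => 1 * x + e) @^-1` `]e, +oo[ = `]0, +oo[%classic.
    by apply/seteqP; split => z; rewrite /= !in_itv /= !andbT mul1r ltrDr.
  rewrite mul1e /J (integral_kappa a_gt0 b_gt0 x (measurable_q _) (q_ge0 _)).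
  rewrite -ge0_integralZl_EFin//; last first.
    by move=> t; rewrite /= in_itv /= andbT; exact: V0.
  rewrite -ge0_integralD//.
  - apply: eq_integral => t; rewrite inE /= in_itv /= andbT => t0.
    by rewrite mul1r U'E ?addr_gt0// conv.
  - apply: measurable_funTS; apply: (measurableT_comp mU').
    by apply: measurable_funD => //; exact: measurable_funM.
  - move=> t; rewrite /= in_itv /= andbT => t0.
    by rewrite mule_ge0 ?lee_fin//; exact: V0.
  - exact: measurable_funeM.
have W2 : (\int[mu]_(t in `]0%R, +oo[) U t =
    \int[mu]_(t in `]e, +oo[) U' t + \int[mu]_(t in `]0%R, e]) U t)%E.
  have -> : (\int[mu]_(t in `]0%R, e]) U t = \int[mu]_(t in `]0%R, e]) U' t)%E.
    by apply: eq_integral => t; rewrite inE /= in_itv /= => /andP[t0 _]; rewrite U'E.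
  have -> : (\int[mu]_(t in `]0%R, +oo[) U t = \int[mu]_(t in `]0%R, +oo[) U' t)%E.
    by apply: eq_integral => t; rewrite inE /= in_itv /= andbT => t0; rewrite U'E.
  rewrite addeC -ge0_integral_setU//=.
  - congr (integral _ _ _); apply/seteqP; split => t /=; rewrite !in_itv /= !andbT.
      by move=> ->; case: (leP t e); [left|right].
    by move=> [/andP[]//|]; exact: lt_trans.
  - exact: measurable_funTS.
  - apply/disj_setPS => t /=; rewrite !in_itv /= !andbT => -[/andP[_ h1] h2].
    by move: (lt_le_trans h2 h1); rewrite ltxx.
(* The common term of [W1] and [W2] can be cancelled only if it is finite; it is dominated by the
   mass of kappa on ]0,x[. *)
have fin : (\int[mu]_(t in `]e, +oo[) U' t)%E \is a fin_num.
  rewrite ge0_fin_numE; last by apply: integral_ge0.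
  apply: (@le_lt_trans _ _ (\int[mu]_(t in `]0%R, +oo[) U t)%E).
    by rewrite W2 leeDl// integral_ge0.
  by rewrite integral_U integral_kappa_lty.
move: W1; rewrite W2.
move=> /(congr1 (fun z => z - \int[mu]_(t in `]e, +oo[) U' t)%E).
by rewrite !(addeC (\int[mu]_(t in `]e, +oo[) U' t)%E) !addeK.
Qed.

Let igamma_quotS (s c : R) : 0 < s -> igamma s c / Gamma s = s * (igamma s c / Gamma (s + 1)).
Proof. by move=> s0; rewrite GammaS//; field; rewrite !gt_eqF// Gamma_gt0. Qed.

Let Gamma_inv_le (s : R) : 0 <= s -> (Gamma (s + 1))^-1 <= expR 1.
Proof.
move=> s0; rewrite -[expR 1]invrK -expRN lef_pV2 ?posrE ?expR_gt0 ?Gamma_gt0 ?ltr_wpDl//.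
exact: Gamma_ge_expRN1.
Qed.

(** Bounds Gamma(s, bx)/Gamma(s+1) for 0 <= s <= 1, by [igamma_le] and [Gamma_inv_le]; hence P(H_t
    >= x) <= C a t while a t <= 1. *)
Let C := (E1 (b * x) + 1) * expR 1.

Let U_ge (t : R) : 0 < t -> a * t <= 1 -> ((1 - C * (a * t))%:E <= U t)%E.
Proof.
move=> t0 at1; have at0 : 0 < a * t by rewrite mulr_gt0.
have -> : U t = (1 - P [set w | (x <= H t w)%R])%E.
  rewrite -probability_setC.
    by congr (P _); apply/seteqP; split => w /=; rewrite ltNge => /negP.
  rewrite (_ : mkset _ = H t @^-1` `[x, +oo[); first exact: measurable_funPTI.
  by apply/seteqP; split => w; rewrite /= in_itv /= andbT.
rewrite (subordinator_tail_le h_density)// (subordinator_tailE a_gt0 b_gt0 H_gamma h_density)//.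
rewrite -EFinB lee_fin lerD2l lerN2 igamma_quotS// mulrC ler_wpM2r ?(ltW at0)//.
rewrite /C; apply: ler_pM; rewrite ?igamma_ge0 ?invr_ge0 ?(ltW (Gamma_gt0 _)) ?addr_gt0//.
  apply: le_trans (igamma_le _ _) _; rewrite ?mulr_gt0 ?(ltW at0)//.
  by rewrite lerD2l.
by apply: Gamma_inv_le; exact: ltW.
Qed.

Let J_ge0 s : (0 <= J s)%E.
Proof. by apply: integral_ge0 => z _; rewrite mule_ge0 ?lee_fin ?q_ge0// kappa_ge0. Qed.

(** Dividing by e = s/a changes 1/Gamma(s) into a/Gamma(s+1), which is regular at s = 0. The
    right-hand side becomes the mean of [U] over []0, s/a]], which lies between 1 - C s and 1. *)
Let JE (s : R) : 0 < s ->
  ((a / Gamma (s + 1))%:E * J s = (a / s)%:E * \int[mu]_(t in `]0%R, (s / a)%R]) U t)%E.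
Proof.
move=> s0; have sa0 : 0 < s / a by rewrite divr_gt0.
rewrite -(integral_kappa_igamma sa0) muleA -EFinM.
have -> : a * (s / a) = s by field; rewrite gt_eqF.
have -> // : a / Gamma (s + 1) = a / s * (Gamma s)^-1.
by rewrite GammaS//; field; rewrite !gt_eqF// Gamma_gt0.
Qed.

Let integral_cst_itv (s c : R) : 0 < s ->
  ((a / s)%:E * \int[mu]_(t in `]0%R, (s / a)%R]) c%:E = c%:E)%E.
Proof.
move=> s0; rewrite integral_cst//= lebesgue_measure_itv /= lte_fin divr_gt0//.
by rewrite -EFinD -!EFinM; congr EFin; field; rewrite !gt_eqF.
Qed.

Let J_le (s : R) : 0 < s -> ((a / Gamma (s + 1))%:E * J s <= 1)%E.
Proof.
move=> s0; rewrite JE// -[leRHS](integral_cst_itv _ s0).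
apply: lee_wpmul2l; first by rewrite lee_fin divr_ge0 ?ltW.
apply: ge0_le_integral => //.
apply: measurable_funS measurable_U => //.
by apply: subset_itvl; rewrite bnd_simp.
Qed.

Let J_ge (s : R) : 0 < s -> s <= 1 -> C * s <= 1 ->
  ((1 - C * s)%:E <= (a / Gamma (s + 1))%:E * J s)%E.
Proof.
move=> s0 s1 Cs; rewrite JE// -[leLHS](integral_cst_itv _ s0).
have C0 : 0 <= C by rewrite mulr_ge0 ?expR_ge0 ?addr_ge0// -igamma0 ?igamma_ge0 ?mulr_gt0.
apply: lee_wpmul2l; first by rewrite lee_fin divr_ge0 ?ltW.
apply: ge0_le_integral => //.
- by move=> t _; rewrite lee_fin subr_ge0.
- apply: measurable_funS measurable_U => //.
  by apply: subset_itvl; rewrite bnd_simp.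
move=> t; rewrite /= in_itv /= => /andP[t0 ts].
have ats : a * t <= s by rewrite mulrC -ler_pdivlMr.
apply: le_trans (U_ge t0 (le_trans ats s1)).
by rewrite lee_fin lerD2l lerN2 ler_wpM2l.
Qed.

Let S : \bar R := (\int[mu]_(z in `]0%R, x[) (kappa a b z * (a * E1 (b * (x - z)))%:E))%E.

Let measurable_term (f : R -> R) : measurable_fun [set: R] f ->
  measurable_fun (`]0, x[ : set R) (fun z => kappa a b z * (f z)%:E)%E.
Proof.
move=> mf; apply: emeasurable_funM; first exact: measurable_kappa.
by apply/measurable_EFinP; exact: measurable_funTS.
Qed.

Let S_le1 : (S <= 1)%E.
Proof.
pose s (n : nat) : R := n.+1%:R^-1.
have s0 n : 0 < s n by rewrite invr_gt0.
have s1 n : s n <= 1 by rewrite invf_le1// ler1n.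
pose f n z := (kappa a b z * (a / Gamma (s n + 1) * q (s n) z)%:E)%E.
have G0 n : 0 <= a / Gamma (s n + 1) by rewrite divr_ge0 ?ltW// Gamma_gt0// addr_gt0.
have mf n : measurable_fun (`]0, x[ : set R) (f n).
  by apply: measurable_term; exact: measurable_funM.
have f0 n z : (0 <= f n z)%E by rewrite mule_ge0 ?kappa_ge0// lee_fin mulr_ge0.
have If n : (\int[mu]_(z in `]0%R, x[) f n z = (a / Gamma (s n + 1))%:E * J (s n))%E.
  rewrite /J -ge0_integralZl_EFin//; last 2 first.
  - by move=> z _; rewrite mule_ge0 ?kappa_ge0// lee_fin.
  - exact: measurable_term.
  by apply: eq_integral => z _; rewrite /f EFinM muleCA.
have -> : S = (\int[mu]_(z in `]0%R, x[) limn_einf (f ^~ z))%E.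
  apply: eq_integral => z; rewrite inE /= in_itv /= => /andP[z0 zx].
  apply/esym.
  have kfin : kappa a b z \is a fin_num by rewrite ge0_fin_numE ?kappa_ge0// kappa_lty.
  have bxz : 0 < b * (x - z) by rewrite mulr_gt0// subr_gt0.
  have [K K0 HK] := igamma_quot_lip bxz.
  suff fz : f n z @[n --> \oo] --> (kappa a b z * (a * E1 (b * (x - z)))%:E)%E.
    by have [-> _] := cvg_limn_einf_sup fz.
  have -> : (fun n => f n z) =
      (fun n => kappa a b z * (a * (igamma (s n) (b * (x - z)) / Gamma (s n + 1)))%:E)%E.
    by apply/funext => n; rewrite /f /q; congr (_ * _%:E)%E; ring.
  (* Finiteness of kappa z is what allows the limit to be taken in the second factor. *)
  apply: cvgeZl => //; apply: cvg_EFin; first exact: nearW.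
  apply: cvgMr; apply/cvgrPdist_le => e e0.
  near=> n.
  have := HK 0 (s n) (lexx _) (ltW (s0 n)) (s1 n).
  rewrite add0r Gamma1 divr1 igamma0// subr0 distrC => /le_trans; apply.
  (* [K] may be 0, so K + 1 serves as divisor. *)
  have K1 : 0 < K + 1 by rewrite ltr_wpDl.
  have sn : s n <= e / (K + 1).
    rewrite -[e / _]invrK lef_pV2 ?posrE ?invr_gt0 ?divr_gt0//.
    apply: (@le_trans _ _ n%:R); last by rewrite ler_nat.
    by near: n; exact: nbhs_infty_ger.
  apply: (@le_trans _ _ ((K + 1) * s n)); first by rewrite ler_wpM2r ?lerDl// ltW.
  by rewrite mulrC -ler_pdivlMr.
apply: le_trans (fatou mu _ mf _) _ => //.
rewrite limn_einf_lim; apply: lime_le; first exact: is_cvg_einfs.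
apply: nearW => n; apply: (@le_trans _ _ (\int[mu]_(z in `]0%R, x[) f n z)%E).
  by apply: ereal_inf_lbound; exists n => //=.
by rewrite If J_le.
Unshelve. all: by end_near. Qed.

(** The error [s] in [igamma_le] is the same for every z, so against kappa it contributes [s] times
    the finite mass of kappa on ]0,x[. *)
Let J_le_S (s : R) : 0 < s -> s <= 1 ->
  (a%:E * J s <= S + (a * s)%:E * \int[mu]_(z in `]0%R, x[) kappa a b z)%E.
Proof.
move=> s0 s1.
have mq0 : measurable_fun (`]0, x[ : set R) (fun z => kappa a b z * (a * E1 (b * (x - z)))%:E)%E.
  apply: (eq_measurable_fun (fun z => kappa a b z * (a * q 0 z)%:E)%E).
    move=> z; rewrite inE /= in_itv /= => /andP[_ zx].
    by rewrite /q igamma0// mulr_gt0// subr_gt0.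
  by apply: measurable_term; exact: measurable_funM.
have mk : measurable_fun (`]0, x[ : set R) (kappa a b) by exact: measurable_kappa.
have E0 z : 0 < z < x -> 0 <= E1 (b * (x - z)).
  by move=> /andP[_ zx]; rewrite -igamma0 ?igamma_ge0// mulr_gt0// subr_gt0.
rewrite /J /S -!ge0_integralZl_EFin//; last 5 first.
- by move=> z _; exact: kappa_ge0.
- by rewrite mulr_ge0 ?ltW.
- by move=> z _; rewrite mule_ge0 ?kappa_ge0// lee_fin.
- exact: measurable_term.
- exact: ltW.
rewrite -ge0_integralD//.
- apply: ge0_le_integral => //.
  + by move=> z _; rewrite !mule_ge0 ?kappa_ge0 ?lee_fin// ltW.
  + by apply: measurable_funeM; exact: measurable_term.
  + by apply: emeasurable_funD => //; exact: measurable_funeM.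
  + move=> z; rewrite /= in_itv /= => /andP[z0 zx].
    have E0' : 0 <= E1 (b * (x - z)) by rewrite E0// z0.
    rewrite muleCA muleC -EFinM [((a * s)%:E * _)%E]muleC.
    rewrite -ge0_muleDr ?lee_fin ?mulr_ge0 ?(ltW a_gt0) ?(ltW s0)//.
    rewrite muleC -EFinD; apply: lee_wpmul2l; first exact: kappa_ge0.
    rewrite lee_fin -mulrDr ler_wpM2l ?(ltW a_gt0)//.
    by apply: igamma_le; rewrite ?(ltW s0)// mulr_gt0// subr_gt0.
- by move=> z; rewrite /= in_itv /= => zx; rewrite mule_ge0 ?kappa_ge0// lee_fin mulr_ge0 ?E0// ltW.
- by move=> z _; rewrite mule_ge0 ?kappa_ge0// lee_fin mulr_ge0 ?ltW.
- exact: measurable_funeM.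
Qed.

Lemma integral_kappa_E1 :
  (\int[mu]_(z in `]0%R, x[) (kappa a b z * (a * E1 (b * (x - z)))%:E) = 1)%E.
Proof.
rewrite -/S; apply/eqP; rewrite eq_le S_le1 /=.
have S0 : (0 <= S)%E.
  apply: integral_ge0 => z; rewrite /= in_itv /= => /andP[_ zx].
  rewrite mule_ge0 ?kappa_ge0// lee_fin mulr_ge0 ?(ltW a_gt0)//.
  by rewrite -igamma0 ?igamma_ge0// mulr_gt0// subr_gt0.
pose W := (\int[mu]_(z in `]0%R, x[) kappa a b z)%E.
have W0 : (0 <= W)%E by apply: integral_ge0 => z _; exact: kappa_ge0.
have Wfin : W \is a fin_num by rewrite ge0_fin_numE// integral_kappa_lty.
have Sfin : S \is a fin_num by rewrite ge0_fin_numE// (le_lt_trans S_le1)// ltry.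
have [K K0 HK] := @Gamma_lip R.
(* With g = Gamma(s+2) = (s+1) Gamma(s+1), the bounds on J give (1 - C s) g <= (s+1)(S + a s W).
   Here [K] comes from g >= 1 - K s, the 1 from s S <= s, and 2 a W from (s+1) a s W with s <= 1. *)
have key s : 0 < s -> s <= 1 -> C * s <= 1 ->
    1 - s * (C + K + 1 + 2 * (a * fine W)) <= fine S.
  move=> s0 s1 Cs.
  have h1 := J_ge s0 s1 Cs; have h2 := J_le_S s0 s1.
  have Gs := HK 0 s (lexx _) (ltW s0) s1.
  have G2 : Gamma 2 = 1 :> R.
    by rewrite (_ : 2 = 1 + 1 :> R) ?GammaS ?Gamma1 ?mulr1//; ring.
  rewrite add0r G2 subr0 in Gs.
  have GE : Gamma (s + 2) = (s + 1) * Gamma (s + 1).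
    by rewrite (_ : s + 2 = s + 1 + 1) ?GammaS ?addr_gt0//; ring.
  have G1 : 0 < Gamma (s + 1) by rewrite Gamma_gt0// addr_gt0.
  have Jfin : J s \is a fin_num.
    rewrite ge0_fin_numE//; have := J_le s0; rewrite lt_neqAle leey andbT.
    move=> h1'; apply/negP => /eqP Js; move: h1'; rewrite Js gt0_muley ?lte_fin ?divr_gt0//.
  move: h1 h2; rewrite -/W -(fineK Jfin) -(fineK Sfin) -(fineK Wfin) -!EFinM -EFinD !lee_fin.
  rewrite /= [a / _ * _]mulrAC ler_pdivlMr// => h1 h2.
  have SS : fine S <= 1 by rewrite -lee_fin fineK.
  have WW : 0 <= fine W by rewrite fine_ge0.
  have C0 : 0 <= C by rewrite mulr_ge0 ?expR_ge0 ?addr_ge0// -igamma0 ?igamma_ge0 ?mulr_gt0.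
  move: (fine S) (fine W) (fine (J s)) (Gamma (s + 1)) (Gamma (s + 2)) h1 h2 SS WW Gs GE G1.
  move=> S' W' J' g1 g2 h1 h2 SS WW Gs GE G1.
  have g2lo : 1 - K * s <= g2 by move: Gs; rewrite ler_norml => /andP[]; lra.
  have h3 : (1 - C * s) * g2 <= (s + 1) * (S' + a * s * W').
    rewrite GE mulrCA; apply: ler_wpM2l; first by rewrite addr_ge0 ?(ltW s0).
    exact: le_trans h1 h2.
  have h4 : (1 - C * s) * (1 - K * s) <= (1 - C * s) * g2 by rewrite ler_wpM2l// subr_ge0.
  have h5 : 0 <= C * s * (K * s) by exact: (mulr_ge0 (mulr_ge0 C0 (ltW s0)) (mulr_ge0 K0 (ltW s0))).
  have h6 : a * s * W' * s <= a * s * W' * 1.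
    by rewrite ler_wpM2l ?mulr_ge0 ?(ltW a_gt0) ?(ltW s0).
  have h7 : s * S' <= s * 1 by rewrite ler_wpM2l ?(ltW s0).
  have := le_trans h4 h3; nra.
have C0 : 0 <= C by rewrite mulr_ge0 ?expR_ge0 ?addr_ge0// -igamma0 ?igamma_ge0 ?mulr_gt0.
rewrite -(fineK Sfin) lee_fin; apply/ler_addgt0Pr => e e0.
pose M := C + K + 1 + 2 * (a * fine W).
have M0 : 0 < M.
  have : 0 <= a * fine W by rewrite mulr_ge0 ?(ltW a_gt0) ?fine_ge0.
  by rewrite /M; lra.
(* The three terms ensure that the error is at most [e], that s <= 1, and that C s <= 1. *)
pose s := Num.min (e / M) (Num.min 1 (C + 1)^-1).
have s0 : 0 < s by rewrite !lt_min divr_gt0// ltr01 invr_gt0 ltr_wpDl.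
have s1 : s <= 1 by rewrite !ge_min lexx !orbT.
have sC : s <= (C + 1)^-1 by rewrite !ge_min lexx !orbT.
have sM : s * M <= e by rewrite -ler_pdivlMr// ge_min lexx.
have Cs : C * s <= 1.
  have : s * (C + 1) <= 1 by rewrite -ler_pdivlMr ?ltr_wpDl// mul1r.
  by rewrite mulrDr mulr1 mulrC; move: s0; lra.
have := key s s0 s1 Cs; rewrite -/M; lra.
Qed.

End sonine.

(** * The inverse process *)

Section inverse.
Context {R : realType} {a b : R} (a_gt0 : 0 < a) (b_gt0 : 0 < b).
Context {d : measure_display} {T : measurableType d} {P : probability T R}.
Context {H : R -> {RV P >-> R}} {L : R -> {RV P >-> \bar R}} {h l : R -> R -> R}.
Hypothesis H_gamma : is_gamma_subordinator a b H.
Hypothesis L_inverse : is_inverse_of H L.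
Hypothesis h_density : forall t, 0 < t -> is_density (law P (H t)) (h t).
Hypothesis l_density : forall t, 0 < t -> is_density (elaw P (L t)) (l t).
Notation mu := (@lebesgue_measure R).

Lemma lt_first_exit t w x : 0 < t -> 0 < x ->
  (forall s : R, 0 < s -> 0 < H s w) ->
  (forall r s : R, 0 <= r -> r <= s -> H r w <= H s w) ->
  H s w @[s --> x^'+] --> H x w ->
  (x%:E < first_exit H t w)%E <-> H x w < t.
Proof.
move=> t0 x0 pos mono rc; split.
  have [//|tx] := ltP (H x w) t; move=> xL; exfalso.
  have : (first_exit H t w <= x%:E)%E.
    apply: ereal_inf_lbound; exists x => //=; split => // /andP[_ xt].
    by move: (lt_le_trans xt tx); rewrite ltxx.
  by rewrite leNgt xL.
move=> xt.
have F : \forall s \near x^'+, x < s /\ H s w < t.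
  near=> s; split; first by near: s; exact: nbhs_right_gt.
  by near: s; exact: (cvgr_lt _ rc).
have [s [xs st]] := filter_ex F.
apply: (@lt_le_trans _ _ s%:E); first by rewrite lte_fin.
apply: le_ereal_inf_tmp => _ [r [r0 rt] <-]; rewrite lee_fin leNgt; apply/negP => rs.
by apply: rt; rewrite pos//= (le_lt_trans _ st)// mono// ltW.
Unshelve. all: by end_near. Qed.

Lemma ae_lt_inverse (t x : R) : 0 < t -> 0 < x ->
  {ae P, forall w, (x%:E < L t w)%E <-> H x w < t}.
Proof.
move=> t0 x0.
have [_ paths _ _] := H_gamma.1.
(* Positivity is needed at all times outside one null set; the times 1/(n+1) suffice by
   monotonicity. *)
have pos : {ae P, forall w, forall n : nat, 0 < H n.+1%:R^-1 w}.
  by apply/ae_foralln => n; apply: (subordinator_gt0 H_gamma h_density).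
have Lt := L_inverse t0.
apply: filterS3 paths pos Lt => w [mono rc] posw ->.
apply: lt_first_exit => //; last by apply: rc; exact: ltW.
move=> s s0; have [n hn] := ltr_add_invr s0; rewrite add0r in hn.
by apply: lt_le_trans (posw n) _; apply: mono; rewrite ?invr_ge0// ltW.
Qed.

Let phi t s := igamma s (b * t) / Gamma (s + 1).

Lemma subordinator_lt (t x : R) : 0 < t -> 0 < x ->
  P [set w | (H x w < t)%R] = (1 - a * x * phi t (a * x))%:E.
Proof.
move=> t0 x0; have ax0 : 0 < a * x by rewrite mulr_gt0.
rewrite (_ : [set w | H x w < t] = ~` [set w | t <= H x w]); last first.
  by apply/seteqP; split => w /=; rewrite ltNge => /negP.
rewrite probability_setC; last first.
  rewrite (_ : mkset _ = H x @^-1` `[t, +oo[); first exact: measurable_funPTI.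
  by apply/seteqP; split => w; rewrite /= in_itv /= andbT.
rewrite (subordinator_tail_le h_density)// (subordinator_tailE a_gt0 b_gt0 H_gamma h_density)//.
rewrite -EFinB; congr (_ - _)%:E.
by rewrite /phi GammaS//; field; rewrite !gt_eqF ?Gamma_gt0.
Qed.

Lemma integral_inverse_density (t x y : R) : 0 < t -> 0 < x -> x < y ->
  (\int[mu]_(z in `]x, y]) (l t z)%:E =
   (a * y * phi t (a * y) - a * x * phi t (a * x))%:E)%E.
Proof.
move=> t0 x0 xy; have y0 : 0 < y by exact: lt_trans xy.
have [_ _ lE _] := l_density t0; rewrite -lE//.
have mL z : measurable [set w | (z%:E < L t w)%E].
  rewrite (_ : mkset _ = L t @^-1` `]z%:E, +oo%E]); last first.
    by apply/seteqP; split => w; rewrite /= in_itv /= leey andbT.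
  by apply: measurable_funPTI; exact: emeasurable_itv.
have mH z : measurable [set w | (H z w < t)%R].
  rewrite (_ : mkset _ = H z @^-1` `]-oo, t[); first exact: measurable_funPTI.
  by apply/seteqP; split => w; rewrite /= in_itv.
have PL z : 0 < z -> P [set w | (z%:E < L t w)%E] = (1 - a * z * phi t (a * z))%:E.
  by move=> z0; rewrite -subordinator_lt//; apply: ae_measure_eq => //; exact: ae_lt_inverse.
have mI : measurable (L t @^-1` (EFin @` `]x, y])).
  by apply: measurable_funPTI; apply: measurable_image_EFin; exact: measurable_itv.
(* The value +oo of L t belongs to the event y < L t, so [elaw] sees exactly the finite part between
   x and y. *)
have E : P [set w | (x%:E < L t w)%E] =
    (elaw P (L t) `]x, y] + P [set w | (y%:E < L t w)%E])%E.
  rewrite -measureU//.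
  - congr (P _); apply/seteqP; split => w /=.
      move=> xL; have [Ly|] := leP (L t w) y%:E; [left|by right].
      case: (L t w) xL Ly => [r| |]//=; rewrite lte_fin lee_fin => xr ry.
      by exists r => //; rewrite in_itv /= xr.
    move=> [[r]|]; last by apply: lt_trans; rewrite lte_fin.
    by rewrite in_itv /= => /andP[xr _] <-; rewrite lte_fin.
  - apply/seteqP; split => w //= -[[r]]; rewrite in_itv /= => /andP[_ ry] <-.
    by rewrite lte_fin ltNge ry.
have fy : P [set w | (y%:E < L t w)%E] \is a fin_num by exact: fin_num_measure.
move: E => /(congr1 (fun z => z - P [set w | (y%:E < L t w)])%E); rewrite addeK// => <-.
rewrite (PL x x0) (PL y y0).
move: (a * x * _) (a * y * _) => u v; rewrite -EFinB; congr EFin; ring.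
Qed.

(** The function s phi(s) is not differentiated. The Lipschitz bound for phi controls its difference
    quotients over ]x,y], and [density_le] and [density_ge] carry this to the point x with an error
    at most M x. *)
Lemma inverse_density_cvg (t : R) : 0 < t -> l t x @[x --> 0^'+] --> a * E1 (b * t).
Proof.
move=> t0; have [ml l0 _ lc] := l_density t0.
have bt0 : 0 < b * t by rewrite mulr_gt0.
have [K K0 HK] := igamma_quot_lip bt0.
have phi0 : phi t 0 = E1 (b * t) by rewrite /phi add0r Gamma1 divr1 igamma0.
(* One a^2 K comes from phi(ax) - phi(0); two come from phi(ay) - phi(ax), which is multiplied by a
   y <= 2 a x. *)
pose M := 3 * (a ^+ 2 * K).
have M0 : 0 <= M by rewrite mulr_ge0// mulr_ge0// sqr_ge0.
have main x : 0 < x -> 2 * (a * x) <= 1 -> `|a * E1 (b * t) - l t x| <= M * x.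
  move=> x0 ax.
  (* The window y <= 2x keeps the error proportional to x, and 2 a x <= 1 keeps a x and a y in
     [0, 1], where the Lipschitz bound holds. *)
  have key y : x < y -> y <= x + x ->
      `|a * y * phi t (a * y) - a * x * phi t (a * x) - a * E1 (b * t) * (y - x)| <= M * x * (y - x).
    move=> xy yx.
    have ax0 : 0 <= a * x by rewrite mulr_ge0 ?ltW.
    have axy : a * x <= a * y by rewrite ler_pM2l ?ltW.
    have ay1 : a * y <= 2 * (a * x).
      have : a * y <= a * (x + x) by rewrite ler_pM2l. 
      lra.
    have ax1 : a * x <= 1 by lra.
    have h1 : `|phi t (a * x) - E1 (b * t)| <= K * (a * x).
      by rewrite -phi0 -[X in K * X]subr0; exact: HK.
    have h2 : `|phi t (a * y) - phi t (a * x)| <= K * (a * (y - x)).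
      by rewrite mulrBr; exact: HK _ _ ax0 axy (le_trans ay1 ax).
    move: (phi t (a * x)) (phi t (a * y)) (E1 (b * t)) h1 h2 => p1 p2 E h1 h2.
    have -> : a * y * p2 - a * x * p1 - a * E * (y - x) =
      a * (y - x) * (p1 - E) + a * y * (p2 - p1) by ring.
    apply: le_trans (ler_normD _ _) _.
    have ayx : 0 <= a * (y - x) by rewrite mulr_ge0 ?subr_ge0 ?ltW.
    have ay0 : 0 <= a * y by exact: le_trans axy.
    rewrite normrM [X in _ + X]normrM (ger0_norm ayx) (ger0_norm ay0).
    have -> : M * x * (y - x) = a * (y - x) * (K * (a * x)) + 2 * (a * x) * (K * (a * (y - x))).
      by rewrite /M; ring.
    apply: lerD; first by rewrite ler_wpM2l.
    by apply: ler_pM.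
  rewrite ler_norml; apply/andP; split.
    rewrite lerBrDl -lerBrDr opprK.
    apply: (density_le ml l0 (lc _ x0) x0) => y xy yx.
    rewrite integral_inverse_density// lee_fin mulrDl -lerBlDl.
    exact: le_trans (ler_norm _) (key y xy yx).
  rewrite lerBlDr -lerBlDl.
  apply: (density_ge ml l0 (lc _ x0) x0) => y xy yx.
  rewrite integral_inverse_density// lee_fin mulrBl.
  by move: (key y xy yx); rewrite ler_norml => /andP[+ _]; rewrite lerBrDr [X in X <= _ -> _]addrC.
have M1 : 0 < M + 1 by rewrite ltr_wpDl.
apply/cvgrPdist_le => e e0.
near=> x.
have x0 : 0 < x by near: x; exact: nbhs_right_gt.
apply: le_trans (main x x0 _) _.
  rewrite mulrA -ler_pdivlMl ?mulr_gt0// mulr1.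
  by near: x; apply: nbhs_right_le; rewrite invr_gt0 mulr_gt0.
apply: (@le_trans _ _ ((M + 1) * x)); first by rewrite ler_wpM2r ?lerDl// ltW.
rewrite mulrC -ler_pdivlMr//.
by near: x; apply: nbhs_right_le; rewrite divr_gt0.
Unshelve. all: by end_near. Qed.

End inverse.

Unset Implicit Arguments.
Set Strict Implicit.
Set Printing Implicit Defensive.

Theorem theorem7 (R : realType) (a b : R) (a_gt0 : 0 < a) (b_gt0 : 0 < b)
    (d : measure_display) (T : measurableType d) (P : probability T R)
    (H : R -> {RV P >-> R}) (L : R -> {RV P >-> \bar R})
    (h l : R -> R -> R)
    (H_gamma : is_gamma_subordinator a b H)
    (L_inverse : is_inverse_of H L)
    (h_density : forall t, 0 < t -> is_density (law P (H t)) (h t))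
    (l_density : forall t, 0 < t -> is_density (elaw P (L t)) (l t)) :
  [/\ forall t, 0 < t -> cvg (l t x @[x --> 0^'+]),
      sonine_pair (potential_density h) (density_at0 l),
      forall x, 0 < x ->
        potential_density h x = (b / a * expR (- (b * x)) * nu (b * x) (-1))%:E &
      forall x, 0 < x -> density_at0 l x = a * E1 (b * x)].
Proof.
have lcvg t : 0 < t -> l t x @[x --> 0^'+] --> a * E1 (b * t).
  exact: (inverse_density_cvg a_gt0 b_gt0 H_gamma L_inverse h_density l_density).
have l0E t : 0 < t -> density_at0 l t = a * E1 (b * t).
  by move=> t0; apply: cvg_lim => //; exact: lcvg.
have potE x : 0 < x -> potential_density h x = kappa a b x.
  move=> x0; apply: eq_integral => t; rewrite inE /= in_itv /= andbT => t0.
  by rewrite (subordinator_density a_gt0 b_gt0 H_gamma h_density).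
split => //.
- by move=> t t0; apply/cvg_ex; exists (a * E1 (b * t)); exact: lcvg.
- move=> x x0; rewrite -(integral_kappa_E1 a_gt0 b_gt0 H_gamma h_density x0).
  apply: eq_integral => z; rewrite inE /= in_itv /= => /andP[z0 zx].
  by rewrite potE// l0E// subr_gt0.
- by move=> x x0; rewrite potE// kappa_nu.
Qed.
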